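(* Let $f: M \to N$ be a smooth map, where $M$ is a locally convex manifold and $N$ is a Banach manifold, and let $m \in M$. Then $f$ can be brought into a normal form at $m$ if and only if the differential $T_m f: T_m M \to T_{f(m)} N$ is a regular operator. In particular, every smooth map $f: M \to N$ from a locally convex manifold $M$ to a finite-dimensional manifold $N$ can be brought into a normal form at every point.
   Context: Manifolds are smooth manifolds modeled on (possibly infinite-dimensional) locally convex spaces, with smoothness of maps between locally convex spaces in the usual Michal--Bastiani sense. A chart $\kappa: M \supseteq U' \to U \subseteq X$ at a point $m$ satisfies $\kappa(m) = 0$, with $U'$ an open neighborhood of $m$ and $U$ an open neighborhood of $0$ in the model space $X$. Regular operator: a continuous linear map $T: X \to Y$ between locally convex spaces is regular if it is relatively open (i.e. open onto its image) and its kernel and its image are closed, topologically complemented subspaces. Abstract normal form: a tuple $(X, Y, \hat f, f_{\mathrm{sing}})$ where (1) $X$ and $Y$ are locally convex spaces with topological decompositions $X = \mathrm{ker} \oplus \mathrm{coim}$ and $Y = \mathrm{coker} \oplus \mathrm{im}$ (here $\mathrm{ker}, \mathrm{coim}, \mathrm{coker}, \mathrm{im}$ are just names of the given subspaces); (2) $\hat f: \mathrm{coim} \to \mathrm{im}$ is a linear topological isomorphism; (3) $f_{\mathrm{sing}}: X \supseteq U \to \mathrm{coker}$ is a smooth map defined on an open neighborhood $U$ of $0$ in $X$ such that $f_{\mathrm{sing}}(0, x_2) = 0$ for all $x_2 \in U \cap \mathrm{coim}$ and such that the derivative $T_{(0,0)} f_{\mathrm{sing}}: X \to \mathrm{coker}$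 vanishes. Set $f_{\mathrm{NF}}(x_1,x_2) = \hat f(x_2) + f_{\mathrm{sing}}(x_1,x_2)$ for $(x_1,x_2) \in U \subseteq \mathrm{ker} \oplus \mathrm{coim}$, so $f_{\mathrm{NF}}: X \supseteq U \to Y$. A smooth map $f: M \to N$ can be brought into the normal form $(X, Y, \hat f, f_{\mathrm{sing}})$ at $m \in M$ if there exist charts $\kappa: M \supseteq U' \to U \subseteq X$ at $m$ and $\rho: N \supseteq V' \to V \subseteq Y$ at $f(m)$ such that $f(U') \subseteq V'$, $f_{\mathrm{sing}}$ is defined on $U$ and $\rho \circ f|_{U'} \circ \kappa^{-1} = f_{\mathrm{NF}}$. It can be brought into a normal form at $m$ if this holds for some abstract normal form. *)

(* Defs.v *)
From HB Require Import structures.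
Set Warnings "-notation-incompatible-prefix,-notation-overridden".
From mathcomp Require Import all_boot all_order all_algebra.
From mathcomp Require Import all_classical all_reals all_analysis.
Set Implicit Arguments.
Unset Strict Implicit.
Unset Printing Implicit Defensive.
Import Order.TTheory GRing.Theory Num.Theory.
Import numFieldNormedType.Exports.
Local Open Scope classical_set_scope.
Local Open Scope ring_scope.

Record lcsType (R : realType) := Lcs {
  lcs_sort :> tvsType R;
  lcs_hausdorff : hausdorff_space lcs_sort
}.

Section linear_topology.
Context (R : realType).

Definition linear_subspace (X : tvsType R) (A : set X) : Prop :=
  A 0 /\ forall (a : R) (x y : X), A x -> A y -> A (a *: x + y).

(* X = A (+) B topologically: [x |-> (pr1 x, pr2 x)] is the continuous inverse
   of the (always continuous) addition map A * B -> X. *)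
Record decomposition (X : tvsType R) := Decomposition {
  summand1 : set X;
  summand2 : set X;
  pr1 : X -> X;
  pr2 : X -> X;
  summand1_subspace : linear_subspace summand1;
  summand2_subspace : linear_subspace summand2;
  summand_disjoint : summand1 `&` summand2 = [set 0];
  pr1_in : forall x, summand1 (pr1 x);
  pr2_in : forall x, summand2 (pr2 x);
  pr_add : forall x, pr1 x + pr2 x = x;
  pr1_continuous : continuous pr1;
  pr2_continuous : continuous pr2
}.

Definition complemented (X : tvsType R) (A : set X) : Prop :=
  exists D : decomposition X, summand1 D = A.

Definition relatively_open (X Y : tvsType R) (T : X -> Y) : Prop :=
  forall U : set X, open U ->
    exists2 V : set Y, open V & T @` U = V `&` range T.

Record regular_operator (X Y : tvsType R) (T : X -> Y) : Prop := {
  regular_linear : linear T;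
  regular_continuous : continuous T;
  regular_open : relatively_open T;
  regular_ker_closed : closed (T @^-1` [set 0]);
  regular_ker_compl : complemented (T @^-1` [set 0]);
  regular_im_closed : closed (range T);
  regular_im_compl : complemented (range T)
}.

(* A topological vector space whose topology comes from a Banach space norm *)
Definition banachable (X : tvsType R) : Prop :=
  exists (B : completeNormedModType R) (phi : X -> B) (psi : B -> X),
    [/\ linear phi, continuous phi, continuous psi,
        cancel phi psi & cancel psi phi].

Definition finite_dimensional (X : tvsType R) : Prop :=
  exists (n : nat) (phi : X -> 'rV[R]_n), linear phi /\ bijective phi.

End linear_topology.

Section michal_bastiani.
Context (R : realType).

(* The difference quotient of derive.v, where [derivable] and ['D_v f a] are
   limited to normed modules.  As there, the limit is along h -> 0, h <> 0. *)
Definition is_tvs_derive (X Y : tvsType R) (f : X -> Y) (a v : X) (l : Y) :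
    Prop :=
  (fun h : R => h^-1 *: (f (h *: v + a) - f a)) @ 0^' --> l.

Definition tvs_derivable (X Y : tvsType R) (f : X -> Y) (a v : X) : Prop :=
  exists l, is_tvs_derive f a v l.

(* Unique if Y is Hausdorff; 0 by convention if the limit does not exist *)
Definition tvs_derive (X Y : tvsType R) (f : X -> Y) (a v : X) : Y :=
  xget 0 [set l | is_tvs_derive f a v l].

(* f is C^n on U in the Michal-Bastiani sense: C^(n+1) means that all the
   directional derivatives exist and that df : U * X -> Y is C^n.  This is used
   for open U only, where it does not depend on the values of f off U. *)
Fixpoint mb_C (n : nat) :
    forall X Y : tvsType R, set X -> (X -> Y) -> Prop :=
  match n with
  | 0 => fun X Y U f => {in U, continuous f}
  | n'.+1 => fun X Y U f =>
      [/\ {in U, continuous f},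
          forall x v, U x -> tvs_derivable f x v &
          mb_C n' (U `*` [set: X]) (fun p : X * X => tvs_derive f p.1 p.2)]
  end.

Definition mb_smooth (X Y : tvsType R) (U : set X) (f : X -> Y) : Prop :=
  forall n, mb_C n U f.

End michal_bastiani.

Section manifold.
Context (R : realType).

(* A homeomorphism from an open set [cdom] of T onto an open set [cimg] of X.
   [cfun] and [cinv] are total; their values off these sets are irrelevant. *)
Record chart (T : topologicalType) (X : tvsType R) := Chart {
  cdom : set T;
  cimg : set X;
  cfun :> T -> X;
  cinv : X -> T;
  cdom_open : open cdom;
  cimg_open : open cimg;
  cfun_img : forall t, cdom t -> cimg (cfun t);
  cinv_dom : forall x, cimg x -> cdom (cinv x);
  cfunK : forall t, cdom t -> cinv (cfun t) = t;
  cinvK : forall x, cimg x -> cfun (cinv x) = x;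
  cfun_continuous : {in cdom, continuous cfun};
  cinv_continuous : {in cimg, continuous cinv}
}.

Definition smooth_transition (T : topologicalType) (X Y : tvsType R)
    (c : chart T X) (d : chart T Y) : Prop :=
  mb_smooth (cimg c `&` cinv c @^-1` cdom d) (d \o cinv c).

Definition compatible (T : topologicalType) (X Y : tvsType R)
    (c : chart T X) (d : chart T Y) : Prop :=
  smooth_transition c d /\ smooth_transition d c.

(* Every chart of the atlas may have its own model space, as in the case of a
   manifold whose connected components have different models. *)
Record lcManifold := LcManifold {
  carrier :> topologicalType;
  atlas : forall X : lcsType R, set (chart carrier X);
  carrier_hausdorff : hausdorff_space carrier;
  atlas_cover : forall m : carrier,
    exists (X : lcsType R) (c : chart carrier X), atlas c /\ cdom c m;
  atlas_compatible : forall (X Y : lcsType R)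
    (c : chart carrier X) (d : chart carrier Y),
    atlas c -> atlas d -> compatible c d
}.

Definition banach_manifold (M : lcManifold) : Prop :=
  forall (X : lcsType R) (c : chart M X), atlas c -> banachable X.

Definition finite_dim_manifold (M : lcManifold) : Prop :=
  forall (X : lcsType R) (c : chart M X), atlas c -> finite_dimensional X.

(* Membership in the maximal atlas *)
Definition smooth_chart (M : lcManifold) (X : lcsType R) (c : chart M X) :
    Prop :=
  forall (Y : lcsType R) (d : chart M Y), atlas d -> compatible c d.

Definition smooth_map (M N : lcManifold) (f : M -> N) : Prop :=
  continuous f /\
  forall (X Y : lcsType R) (c : chart M X) (d : chart N Y),
    atlas c -> atlas d ->
    mb_smooth (cimg c `&` (f \o cinv c) @^-1` cdom d) (d \o f \o cinv c).

(* The tangent space at m is realized in a chosen chart around m: it is the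
   model space of that chart, and the differential is the derivative of the
   local representative in the chosen charts.  Another choice of charts changes
   it by the derivatives of the transition maps, which are linear topological
   isomorphisms. *)
Definition model_at (M : lcManifold) (m : M) : lcsType R :=
  sval (cid (atlas_cover m)).

Definition chart_at (M : lcManifold) (m : M) : chart M (model_at m) :=
  sval (cid (svalP (cid (atlas_cover m)))).

Definition tangent_space (M : lcManifold) (m : M) : lcsType R := model_at m.

Definition tangent_map (M N : lcManifold) (f : M -> N) (m : M) :
    tangent_space m -> tangent_space (f m) :=
  tvs_derive (chart_at (f m) \o f \o cinv (chart_at m)) (chart_at m m).

End manifold.

Arguments tangent_space {R M} m.
Arguments tangent_map {R M N} f m _.

Section normal_form.
Context (R : realType).

(* X = ker (+) coim and Y = coker (+) im are [nf_source] and [nf_target].  Only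
   the values of [nf_hat] on coim and of [nf_sing] on [nf_dom] matter.  Since
   coker is closed in Y, f_sing is smooth as a map into coker if and only if it
   is smooth as a map into Y. *)
Record normal_form (X Y : lcsType R) := NormalForm {
  nf_source : decomposition X;
  nf_target : decomposition Y;
  nf_ker := summand1 nf_source;
  nf_coim := summand2 nf_source;
  nf_coker := summand1 nf_target;
  nf_im := summand2 nf_target;
  nf_hat : X -> Y;
  nf_hat_inv : Y -> X;
  nf_hat_linear : forall (a : R) (x y : X), nf_coim x -> nf_coim y ->
    nf_hat (a *: x + y) = a *: nf_hat x + nf_hat y;
  nf_hat_im : forall x, nf_coim x -> nf_im (nf_hat x);
  nf_hat_inv_coim : forall y, nf_im y -> nf_coim (nf_hat_inv y);
  nf_hatK : forall x, nf_coim x -> nf_hat_inv (nf_hat x) = x;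
  nf_hat_invK : forall y, nf_im y -> nf_hat (nf_hat_inv y) = y;
  nf_hat_continuous : {within nf_coim, continuous nf_hat};
  nf_hat_inv_continuous : {within nf_im, continuous nf_hat_inv};
  nf_dom : set X;
  nf_dom_open : open nf_dom;
  nf_dom0 : nf_dom 0;
  nf_sing : X -> Y;
  nf_sing_coker : forall x, nf_dom x -> nf_coker (nf_sing x);
  nf_sing_smooth : mb_smooth nf_dom nf_sing;
  nf_sing_coim : forall x, nf_dom x -> nf_coim x -> nf_sing x = 0;
  nf_sing_derive0 : forall v, tvs_derive nf_sing 0 v = 0
}.

Definition nf_map (X Y : lcsType R) (F : normal_form X Y) (x : X) : Y :=
  nf_hat F (pr2 (nf_source F) x) + nf_sing F x.

Definition brought_into (M N : lcManifold R) (f : M -> N) (m : M)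
    (X Y : lcsType R) (F : normal_form X Y) : Prop :=
  exists (kappa : chart M X) (rho : chart N Y),
    [/\ smooth_chart kappa, cdom kappa m & kappa m = 0] /\
    [/\ smooth_chart rho, cdom rho (f m) & rho (f m) = 0] /\
    [/\ f @` cdom kappa `<=` cdom rho,
        cimg kappa `<=` nf_dom F &
        forall x, cimg kappa x -> rho (f (cinv kappa x)) = nf_map F x].

Definition has_normal_form (M N : lcManifold R) (f : M -> N) (m : M) : Prop :=
  exists (X Y : lcsType R) (F : normal_form X Y), brought_into f m F.

End normal_form.

(* Main.v *)
Require Import Defs.
From HB Require Import structures.
From mathcomp Require Import all_boot all_order all_algebra.
From mathcomp Require Import all_classical all_reals all_analysis.
From mathcomp Require Import ring lra.

(* The key object is a generalized inverse S of T = T_m f, i.e. TST = T and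
   STS = S: such a continuous linear S exists if and only if T is regular, and
   then ST and TS are the projections onto coim and im.

   If T is regular, work in charts centred at m and f(m) and put r = f - T.  The
   map psi(x) = x + S(r(x)) straightens f, since S f = ST psi.  To invert it,
   set u = -r(x): then x = z + S u with z = psi(x), so that u solves the fixed
   point equation u = -r(z + S u), in which only u ranges over the Banach
   space Y while z is a parameter in the locally convex space X.  As the
   second derivative is continuous, the right-hand side is a uniform contraction
   in u near 0, so there is a unique solution u(z).  Its derivative in direction
   w solves an equation of the same kind with parameter (z, w), whence
   u is smooth by induction.  In the chart psi the im component TS f is linear,
   and the shear y |-> y - (1 - TS) f(psi^-1(S y)) of Y makes the
   coker component vanish on coim.

   Conversely the derivative of a normal form at 0 has the generalized inverse
   f_hat^-1 o pr_im, which the differentials of the charts carry over to T_m f.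

   If N is finite-dimensional, every continuous linear map into T_f(m) N has a
   generalized inverse, defined by lifting a basis of the image. *)

Set Implicit Arguments.
Unset Strict Implicit.
Unset Printing Implicit Defensive.
Import Order.TTheory GRing.Theory Num.Theory.
Import numFieldNormedType.Exports.
Local Open Scope classical_set_scope.
Local Open Scope ring_scope.

(** * Limits and convexity in locally convex spaces *)

Section tvs_limits.
Context (R : realType).

Lemma cvg_near_eq (X : topologicalType) (T : Type) (F : set_system T)
    {FF : Filter F} (f g : T -> X) (l : X) :
  f @ F --> l -> (\forall x \near F, f x = g x) -> g @ F --> l.
Proof. by move=> fl fg; apply: cvg_trans fl; exact: near_eq_cvg. Qed.

Lemma tvs_cvgD (X : tvsType R) (T : Type) (F : set_system T) {FF : Filter F}
    (f g : T -> X) (a b : X) :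
  f @ F --> a -> g @ F --> b -> (f x + g x) @[x --> F] --> a + b.
Proof.
move=> fa gb; apply: (cvg_comp (fun x => (f x, g x)) (fun p => p.1 + p.2)).
  exact: cvg_pair fa gb.
exact: (add_continuous (a, b)).
Qed.

Lemma tvs_cvgZ (X : tvsType R) (T : Type) (F : set_system T) {FF : Filter F}
    (k : T -> R) (f : T -> X) (c : R) (a : X) :
  k @ F --> c -> f @ F --> a -> (k x *: f x) @[x --> F] --> c *: a.
Proof.
move=> kc fa.
apply: (cvg_comp (fun x => (k x, f x)) (fun p : R^o * X => p.1 *: p.2)).
  exact: cvg_pair kc fa.
exact: (@scale_continuous R X (c, a)).
Qed.

Lemma tvs_cvgN (X : tvsType R) (T : Type) (F : set_system T) {FF : Filter F}
    (f : T -> X) (a : X) : f @ F --> a -> (- f x) @[x --> F] --> - a.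
Proof.
move=> fa; apply: (cvg_comp f -%R fa).
exact: (@opp_continuous X a).
Qed.

Lemma tvs_cvgB (X : tvsType R) (T : Type) (F : set_system T) {FF : Filter F}
    (f g : T -> X) (a b : X) :
  f @ F --> a -> g @ F --> b -> (f x - g x) @[x --> F] --> a - b.
Proof. by move=> fa gb; apply: tvs_cvgD => //; exact: tvs_cvgN. Qed.

Definition convex_subset (X : tvsType R) (K : set X) :=
  forall (a b : X) (t : R), 0 <= t -> t <= 1 -> K a -> K b ->
  K (t *: a + (1 - t) *: b).

Lemma nbhs_convex (X : tvsType R) (x : X) (U : set X) : nbhs x U ->
  exists K : set X, [/\ open K, K x, K `<=` U & convex_subset K].
Proof.
move=> Ux; have [B Bc [Bo /(_ x U Ux)[K [BK Kx] KU]]] := @locally_convex R X.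
exists K; split => //; first exact: Bo.
move=> a b t t0 t1 Ka Kb.
have := Bc K (mem_set BK) a b (Itv01 t0 t1) (mem_set Ka) (mem_set Kb).
by rewrite inE.
Qed.

Lemma hausdorff_prod (X Y : topologicalType) :
  hausdorff_space X -> hausdorff_space Y -> hausdorff_space (X * Y)%type.
Proof.
move=> hX hY [x1 y1] [x2 y2] cl; congr pair.
  apply: hX => A B nA nB.
  have [||[a b] [[/= Aa _] [/= Ba _]]] := cl (A `*` setT) (B `*` setT).
  - by exists (A, setT) => //; split => //; exact: filterT.
  - by exists (B, setT) => //; split => //; exact: filterT.
  by exists a.
apply: hY => A B nA nB.
have [||[a b] [[/= _ Aa] [/= _ Ba]]] := cl (setT `*` A) (setT `*` B).
- by exists (setT, A) => //; split => //; exact: filterT.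
- by exists (setT, B) => //; split => //; exact: filterT.
by exists b.
Qed.

Lemma open_setX (X Y : topologicalType) (U : set X) (V : set Y) :
  open U -> open V -> open (U `*` V).
Proof.
rewrite !openE => oU oV [x y] [/= Ux Vy].
by exists (U, V) => //; split; [exact: oU|exact: oV].
Qed.

Lemma open_preimage_in (X Y : topologicalType) (f : X -> Y) (U : set X)
    (V : set Y) : open U -> {in U, continuous f} -> open V ->
  open (U `&` f @^-1` V).
Proof.
move=> oU cf oV; rewrite openE => x [Ux Vfx]; apply: filterI.
  exact: open_nbhs_nbhs.
by apply: cf; [rewrite inE|exact: open_nbhs_nbhs].
Qed.

(* Call an interval good if the mean slope of g over it lies in K.  By convexity
   good intervals can be concatenated, and all small intervals containing a
   given point are good; hence the supremum of the x such that [a, x] is good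
   is b. *)
Lemma mean_value_convex (X : tvsType R) (K : set X) (g : R -> X) (a b : R) :
  convex_subset K -> a < b ->
  (forall t, a <= t <= b -> exists2 l : X, nbhs l K &
     (h^-1 *: (g (t + h) - g t)) @[h --> 0^'] --> l) ->
  K ((b - a)^-1 *: (g b - g a)).
Proof.
move=> cK ab dg.
pose P x y := K ((y - x)^-1 *: (g y - g x)).
have cat x y z : x < y -> y < z -> P x y -> P y z -> P x z.
  move=> xy yz Pxy Pyz; have xz := lt_trans xy yz.
  have t0 : 0 <= (y - x) / (z - x) by rewrite divr_ge0 // subr_ge0 ltW.
  have t1 : (y - x) / (z - x) <= 1.
    by rewrite ler_pdivrMr ?subr_gt0 // mul1r lerD2r ltW.
  have := cK _ _ _ t0 t1 Pxy Pyz.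
  have E1 : (y - x) / (z - x) / (y - x) = (z - x)^-1.
    by field; rewrite !subr_eq0 !gt_eqF.
  have E2 : (1 - (y - x) / (z - x)) / (z - y) = (z - x)^-1.
    by field; rewrite !subr_eq0 !gt_eqF.
  by rewrite !scalerA E1 E2 -scalerDr [_ - g x + _]addrC addrA subrK.
have loc c : a <= c <= b -> exists2 d : R, 0 < d & forall x y,
    c - d < x -> x <= c -> c <= y -> y < c + d -> x < y -> P x y.
  move=> /dg[l lK] /(_ K lK); rewrite /= /dnbhs /within /=.
  move=> /nbhs_ballP[d d0 dK]; exists d => // x y dx xc cy yd xy.
  have Pl : x < c -> P x c.
    move=> xc'; have := dK (x - c); rewrite /ball /= sub0r normrN.
    rewrite ltr0_norm ?subr_lt0 // opprB => /(_ _ _); rewrite subr_eq0.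
    rewrite (lt_eqF xc') [c + _]addrC subrK => H; rewrite /P.
    rewrite -[c - x]opprB -[g c - g x]opprB invrN scaleNr scalerN opprK.
    by apply: H => //; lra.
  have Pr : c < y -> P c y.
    move=> cy'; have := dK (y - c); rewrite /ball /= sub0r normrN.
    rewrite gtr0_norm ?subr_gt0 // => /(_ _ _); rewrite subr_eq0.
    by rewrite (gt_eqF cy') [c + _]addrC subrK => H; apply: H => //; lra.
  move: xc cy; rewrite !le_eqVlt => /predU1P[xc|xc] /predU1P[cy|cy].
  - by move: xy; rewrite xc -cy ltxx.
  - by rewrite xc; exact: Pr.
  - by rewrite -cy; exact: Pl.
  - by apply: (cat _ c); [| |exact: Pl|exact: Pr].
pose S := [set x | a < x <= b /\ P a x].
have [d0 d00 H0] := loc a ltac:(lra).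
have S0 : S (Num.min b (a + d0 / 2)).
  have m1 : a < Num.min b (a + d0 / 2) by rewrite lt_min ab /=; lra.
  split; first by rewrite m1 ge_min lexx.
  have m2 : Num.min b (a + d0 / 2) < a + d0.
    by rewrite gt_min; apply/orP; right; lra.
  by apply: H0 => //; lra.
have Sb : ubound S b by move=> x [/andP[_ ?] _].
have hS : has_sup S by split; [exists (Num.min b (a + d0 / 2))|exists b].
set c := sup S.
have cb : c <= b by apply: ge_sup => //; exists (Num.min b (a + d0 / 2)).
have ac : a < c.
  apply: (lt_le_trans _ (sup_upper_bound hS S0)).
  by case: S0 => /andP[].
have [d d00' H] := loc c ltac:(lra).
have [x Sx cx] := sup_adherent d00' hS.
have xc : x <= c by apply: sup_upper_bound.
have [/andP[ax xb] Pax] := Sx.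
(* [y] lies strictly beyond [c] unless it equals [b]. As the interval from [a] to [y] is good,
   [y <= c], which leaves only [y = b]. *)
pose y := Num.min b (c + d / 2).
have cy : c <= y by rewrite le_min cb /=; lra.
have yd : y < c + d by rewrite gt_min; apply/orP; right; lra.
have yb : y <= b by rewrite ge_min lexx.
have Pay : P a y.
  move: (le_trans xc cy); rewrite le_eqVlt => /predU1P[<- //|xy].
  by apply: (cat _ x) => //; exact: H.
have yc : y <= c.
  apply: sup_upper_bound => //; split => //.
  by rewrite yb (lt_le_trans ax) // (le_trans xc).
suff -> : b = y by [].
by move: yc; rewrite /y; case: (leP b (c + d / 2)) => //; lra.
Qed.

End tvs_limits.

(** * Directional derivatives of C^1 maps *)

Section tvs_derivative.
Context (R : realType).

Lemma mb_C0P (X Y : tvsType R) (U : set X) (f : X -> Y) :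
  mb_C 0 U f <-> forall x, U x -> {for x, continuous f}.
Proof.
by split=> H x; [move=> Ux; apply: H; rewrite inE|rewrite inE; exact: H].
Qed.

Lemma mb_C_continuous (X Y : tvsType R) (n : nat) (U : set X) (f : X -> Y) :
  mb_C n U f -> forall x, U x -> {for x, continuous f}.
Proof. by move=> H; apply/mb_C0P; case: n H => [|n] // []. Qed.

Lemma mb_C_open_preimage (X Y : tvsType R) (n : nat) (U : set X) (V : set Y)
    (f : X -> Y) : open U -> mb_C n U f -> open V -> open (U `&` f @^-1` V).
Proof.
move=> oU /mb_C_continuous cf oV; apply: open_preimage_in => //.
by move=> x; rewrite inE; exact: cf.
Qed.

Lemma line_cvg (X : tvsType R) (a v : X) : (h *: v + a) @[h --> 0^'] --> a.
Proof.
have H : h @[h --> 0^'] --> (0 : R) by exact: cvg_within.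
have := tvs_cvgD (tvs_cvgZ H (cvg_cst v)) (cvg_cst a).
by rewrite scale0r add0r; apply.
Qed.

Lemma is_tvs_derive_near (X Y : tvsType R) (f g : X -> Y) (a v : X) (l : Y) :
  (\forall x \near a, f x = g x) ->
  is_tvs_derive f a v l -> is_tvs_derive g a v l.
Proof.
move=> fg; apply: cvg_trans; apply: near_eq_cvg.
have fga := nbhs_singleton fg.
have := line_cvg v fg; rewrite !near_simpl; apply: filterS => h /= ->.
by rewrite fga.
Qed.

Lemma is_tvs_derive_unique (X Y : tvsType R) (f : X -> Y) (a v : X) (l : Y) :
  hausdorff_space Y -> is_tvs_derive f a v l -> tvs_derive f a v = l.
Proof.
move=> hY fl; apply: (cvg_unique hY _ fl).
by apply: (@xgetPex Y 0 [set l | is_tvs_derive f a v l]); exists l.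
Qed.

Lemma tvs_deriveP (X Y : tvsType R) (f : X -> Y) (a v : X) :
  tvs_derivable f a v -> is_tvs_derive f a v (tvs_derive f a v).
Proof. exact: (@xgetPex Y 0 [set l | is_tvs_derive f a v l]). Qed.

Lemma tvs_derive_near (X Y : tvsType R) (f g : X -> Y) (a v : X) :
  (\forall x \near a, f x = g x) -> tvs_derive f a v = tvs_derive g a v.
Proof.
move=> fg; rewrite /tvs_derive; congr xget; apply/seteqP; split=> l /=.
  exact: is_tvs_derive_near.
by apply: is_tvs_derive_near; apply: filterS fg.
Qed.

(** Strict differentiability: base point, direction and step vary together. The slope of f along x +
    s v for s between 0 and t is controlled by the derivatives df(x + s v, v), which stay in a
    convex neighbourhood of df(y, w) because df is jointly continuous. *)
Lemma strict_derive (X Y : tvsType R) (U : set X) (f : X -> Y) (y w : X)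
    (K : set Y) : open U -> mb_C 1 U f -> U y -> nbhs (tvs_derive f y w) K ->
  \forall p \near ((y, w), 0 : R),
    p.2 != 0 -> K (p.2^-1 *: (f (p.2 *: p.1.2 + p.1.1) - f p.1.1)).
Proof.
move=> oU [cf df cdf] Uy /nbhs_convex[C [oC Cl CK cC]].
have cdf1 := (mb_C0P _ _).1 cdf (y, w) (conj Uy I).
have M : \forall q \near (y, w), (U `*` setT) q /\ C (tvs_derive f q.1 q.2).
  apply: filterI.
    by apply: open_nbhs_nbhs; split=> //; exact: open_setX openT.
  by apply: cdf1; exact: open_nbhs_nbhs.
(* At parameter s the segment passes through s v + x with velocity v. [phi] records this pair, so
   that [M] pulls back to a neighbourhood of ((y, w), 0). *)
pose phi (p : (X * X) * R) : X * X := (p.2 *: p.1.2 + p.1.1, p.1.2).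
have cphi : phi p @[p --> nbhs ((y, w), 0 : R)] --> (y, w).
  have c11 : (p : (X * X) * R).1.1 @[p --> nbhs ((y, w), 0 : R)] --> y.
    by apply: (cvg_comp _ _ cvg_fst); exact: cvg_fst.
  have c12 : (p : (X * X) * R).1.2 @[p --> nbhs ((y, w), 0 : R)] --> w.
    by apply: (cvg_comp _ _ cvg_fst); exact: cvg_snd.
  have c2 : (p : (X * X) * R).2 @[p --> nbhs ((y, w), 0 : R)] --> (0 : R).
    exact: cvg_snd.
  apply: cvg_pair => //=.
  by have := tvs_cvgD (tvs_cvgZ c2 c12) c11; rewrite scale0r add0r; apply.
have [[A B] /= [nA /nbhs_ballP[d d0 dB]] AB] := cphi _ M.
exists (A, ball (0 : R) d) => /=.
  by split=> //; exact: nbhsx_ballx.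
move=> [[x v] t] /= [Axv]; rewrite /ball /= sub0r normrN => td t0; apply: CK.
have key s : `|s| <= `|t| -> exists2 l : Y, nbhs l C &
    (h^-1 *: (f ((s + h) *: v + x) - f (s *: v + x))) @[h --> 0^'] --> l.
  move=> st; have [|[Us _] Cs] := AB ((x, v), s).
    split=> //=; apply: dB; rewrite /ball /= sub0r normrN.
    exact: le_lt_trans td.
  exists (tvs_derive f (s *: v + x) v); first exact: open_nbhs_nbhs.
  have := tvs_deriveP (df _ v Us); apply: cvg_trans; apply: near_eq_cvg.
  by apply: nearW => h /=; rewrite addrA -scalerDl [h + s]addrC.
(* The mean value lemma needs an ordered interval: a negative [t] is handled on the interval from
   [t] to 0, where both signs of the slope are reversed. *)
have := t0; rewrite neq_lt => /orP[t_lt0|t_gt0].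
  have := @mean_value_convex R Y C (fun s => f (s *: v + x)) t 0 cC t_lt0.
  rewrite sub0r invrN scaleNr -scalerN opprB scale0r add0r; apply.
  move=> s /andP[ts s0]; apply: key.
  by rewrite !ler0_norm ?(ltW t_lt0) // lerN2.
have := @mean_value_convex R Y C (fun s => f (s *: v + x)) 0 t cC t_gt0.
rewrite subr0 scale0r add0r; apply.
by move=> s /andP[s0 ts]; apply: key; rewrite !ger0_norm // ltW.
Qed.

(** The form in which strict differentiability is applied: base point and direction may move along
    any filter while the step tends to 0. *)
Lemma strict_derive_cvg (X Y : tvsType R) (U : set X) (f : X -> Y) (y w : X)
    (T : Type) (F : set_system T) {FF : Filter F} (y_ w_ : T -> X)
    (t_ : T -> R) :
  open U -> mb_C 1 U f -> U y ->
  y_ @ F --> y -> w_ @ F --> w -> t_ @ F --> 0 ->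
  (\forall i \near F, t_ i != 0) ->
  ((t_ i)^-1 *: (f (t_ i *: w_ i + y_ i) - f (y_ i))) @[i --> F]
    --> tvs_derive f y w.
Proof.
move=> oU fC Uy yy ww t0 tn0 K nK.
have c1 : (y_ i, w_ i) @[i --> F] --> (y, w) by exact: cvg_pair yy ww.
have c : ((y_ i, w_ i), t_ i) @[i --> F] --> ((y, w), 0 : R).
  exact: cvg_pair c1 t0.
have /= H := c _ (strict_derive oU fC Uy nK).
apply: (@filterS2 T F _ _ _ _ _ H tn0) => i; exact.
Qed.

Lemma tvs_derive_scale (X Y : tvsType R) (U : set X) (f : X -> Y) (x v : X)
    (a : R) : hausdorff_space Y -> open U -> mb_C 1 U f -> U x ->
  tvs_derive f x (a *: v) = a *: tvs_derive f x v.
Proof.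
move=> hY oU fC Ux; apply: is_tvs_derive_unique => //.
have [->|a0] := eqVneq a 0.
  rewrite !scale0r /is_tvs_derive.
  have -> : (fun h : R => h^-1 *: (f (h *: 0 + x) - f x)) = cst 0.
    by apply/funext => h; rewrite scaler0 add0r subrr scaler0.
  exact: cvg_cst.
have c0 : (h * a) @[h --> 0^'] --> (0 : R).
  have H : h @[h --> 0^'] --> (0 : R) by exact: cvg_within.
  have := tvs_cvgZ (X := R^o) H (cvg_cst a).
  by rewrite scale0r; apply.
have n0 : \forall h \near (0 : R)^', h * a != 0.
  by apply: filterS (nbhs_dnbhs_neq (0 : R)) => h h0; rewrite mulf_neq0.
have H : ((h * a)^-1 *: (f ((h * a) *: v + x) - f x)) @[h --> 0^']
    --> tvs_derive f x v.
  exact: strict_derive_cvg oU fC Ux (cvg_cst x) (cvg_cst v) c0 n0.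
apply: (cvg_near_eq (tvs_cvgZ (cvg_cst a) H)).
apply: nearW => h /=; rewrite !scalerA invfM mulrCA divff // mulr1.
by [].
Qed.

(** The increment along h (v + w) is split at h v + x. Its second half starts at a moving base
    point, which strict differentiability permits. *)
Lemma tvs_deriveD (X Y : tvsType R) (U : set X) (f : X -> Y) (x v w : X) :
  hausdorff_space Y -> open U -> mb_C 1 U f -> U x ->
  tvs_derive f x (v + w) = tvs_derive f x v + tvs_derive f x w.
Proof.
move=> hY oU fC Ux; apply: is_tvs_derive_unique => //.
have n0 := nbhs_dnbhs_neq (0 : R).
have H : h @[h --> 0^'] --> (0 : R) by exact: cvg_within.
have H1 : (h^-1 *: (f (h *: v + x) - f x)) @[h --> 0^'] --> tvs_derive f x v.
  exact: strict_derive_cvg oU fC Ux (cvg_cst x) (cvg_cst v) H n0.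
have H2 : (h^-1 *: (f (h *: w + (h *: v + x)) - f (h *: v + x))) @[h --> 0^']
    --> tvs_derive f x w.
  exact: strict_derive_cvg oU fC Ux (@line_cvg _ x v) (cvg_cst w) H n0.
apply: (cvg_near_eq (tvs_cvgD H1 H2)).
apply: nearW => h /=; rewrite -scalerDr; congr (_ *: _).
by rewrite addrC addrA subrK scalerDr addrA [h *: w + _]addrC.
Qed.

Lemma tvs_derive_linear (X Y : tvsType R) (U : set X) (f : X -> Y) (x : X) :
  hausdorff_space Y -> open U -> mb_C 1 U f -> U x -> linear (tvs_derive f x).
Proof.
move=> hY oU fC Ux a v w.
by rewrite (tvs_deriveD _ _ hY oU) // (tvs_derive_scale _ _ hY oU).
Qed.

Lemma tvs_derive_continuous (X Y : tvsType R) (U : set X) (f : X -> Y) (x : X) :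
  mb_C 1 U f -> U x -> continuous (tvs_derive f x).
Proof.
move=> [_ _ /mb_C0P cdf] Ux v.
apply: (@continuous_comp _ _ _ (fun v => (x, v))
          (fun p => tvs_derive f p.1 p.2)); last exact: cdf.
by apply: cvg_pair; [exact: cvg_cst|exact: cvg_id].
Qed.

(** The quotient of [g \o f] is a quotient of [g] with step h, taken in the direction of the
    difference quotient of [f]; this direction converges to [l]. *)
Lemma is_tvs_derive_comp (X Y Z : tvsType R) (V : set Y) (f : X -> Y)
    (g : Y -> Z) (x v : X) (l : Y) : open V -> mb_C 1 V g -> V (f x) ->
  is_tvs_derive f x v l ->
  is_tvs_derive (g \o f) x v (tvs_derive g (f x) l).
Proof.
move=> oV gC Vfx fl; have n0 := nbhs_dnbhs_neq (0 : R).
have H : h @[h --> 0^'] --> (0 : R) by exact: cvg_within.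
have G : (h^-1 *: (g (h *: (h^-1 *: (f (h *: v + x) - f x)) + f x) - g (f x)))
    @[h --> 0^'] --> tvs_derive g (f x) l.
  exact: strict_derive_cvg oV gC Vfx (cvg_cst (f x)) fl H n0.
apply: (cvg_near_eq G); apply: filterS n0 => h h0 /=.
by rewrite scalerA divff // scale1r subrK.
Qed.

End tvs_derivative.

(** * Michal--Bastiani calculus *)

Section mb_calculus.
Context (R : realType).

Lemma mb_C_sub (n : nat) (X Y : tvsType R) (U V : set X) (f : X -> Y) :
  V `<=` U -> mb_C n U f -> mb_C n V f.
Proof.
elim: n X Y U V f => [|n IH] X Y U V f VU.
  by move=> /mb_C0P cf; apply/mb_C0P => x /VU; exact: cf.
move=> [cf df Cdf]; split.
- by move=> x; rewrite inE => /VU Ux; apply: cf; rewrite inE.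
- by move=> x v /VU; exact: df.
- by apply: IH Cdf => -[x v] /= [/VU].
Qed.

(** Openness of U makes f and g agree near each of its points, so they share their directional
    derivatives whatever their values elsewhere. *)
Lemma mb_C_eq (n : nat) (X Y : tvsType R) (U : set X) (f g : X -> Y) :
  open U -> (forall x, U x -> f x = g x) -> mb_C n U f -> mb_C n U g.
Proof.
elim: n X Y U f g => [|n IH] X Y U f g oU fg.
  move=> /mb_C0P cf; apply/mb_C0P => x Ux.
  have near_fg : \forall y \near x, f y = g y.
    by apply: filterS (open_nbhs_nbhs (conj oU Ux)).
  rewrite /prop_for /continuous_at -(fg x Ux).
  exact: cvg_near_eq (cf x Ux) near_fg.
move=> [cf df Cdf].
have near_fg x : U x -> \forall y \near x, f y = g y.
  by move=> Ux; apply: filterS (open_nbhs_nbhs (conj oU Ux)).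
split.
- move=> x; rewrite inE => Ux.
  rewrite /prop_for /continuous_at -(fg x Ux).
  by apply: cvg_near_eq (near_fg _ Ux); apply: cf; rewrite inE.
- move=> x v Ux; have [l dl] := df x v Ux; exists l.
  exact: is_tvs_derive_near (near_fg x Ux) dl.
- apply: IH Cdf; first exact: open_setX openT.
  by move=> [x v] [/= Ux _]; exact: tvs_derive_near (near_fg x Ux).
Qed.

Lemma mb_CW (n : nat) (X Y : tvsType R) (U : set X) (f : X -> Y) :
  mb_C n.+1 U f -> mb_C n U f.
Proof.
elim: n X Y U f => [|n IH] X Y U f; first by case.
by move=> [cf df Cdf]; split=> //; exact: IH.
Qed.

Lemma is_tvs_derive_affine (X Y : tvsType R) (L : X -> Y) (c : Y) (x v : X) :
  linear L -> is_tvs_derive (fun x => L x + c) x v (L v).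
Proof.
move=> linL.
apply: (cvg_near_eq (cvg_cst (L v))); apply: filterS (nbhs_dnbhs_neq (0 : R)).
move=> h h0 /=; rewrite linL -(addrA (h *: L v)) addrK scalerA mulVf //.
by rewrite scale1r.
Qed.

(** The derivative (x, v) |-> L v is again linear and continuous, so the induction on n closes. *)
Lemma mb_C_affine (n : nat) (X Y : tvsType R) (U : set X) (L : X -> Y) (c : Y) :
  hausdorff_space Y -> linear L -> continuous L ->
  mb_C n U (fun x => L x + c).
Proof.
move=> hY; elim: n X U L c => [|n IH] X U L c linL cL.
  by apply/mb_C0P => x _; apply: tvs_cvgD (cL x) (cvg_cst c).
split.
- by move=> x _; apply: tvs_cvgD (cL x) (cvg_cst c).
- by move=> x v _; exists (L v); exact: is_tvs_derive_affine.
- have -> : (fun p : X * X => tvs_derive (fun x => L x + c) p.1 p.2) =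
      (fun p => (L \o snd) p + 0).
    apply/funext => -[x v] /=; rewrite addr0.
    by apply: is_tvs_derive_unique => //; exact: is_tvs_derive_affine.
  apply: IH; first by move=> a p q /=; exact: linL.
  by move=> p; apply: continuous_comp; [exact: cvg_snd|exact: cL].
Qed.

Lemma mb_C_linear (n : nat) (X Y : tvsType R) (U : set X) (L : X -> Y) :
  hausdorff_space Y -> linear L -> continuous L -> mb_C n U L.
Proof.
move=> hY linL cL; have := @mb_C_affine n X Y U L 0 hY linL cL.
by under eq_fun do rewrite addr0.
Qed.

Lemma mb_C_id (n : nat) (X : tvsType R) (U : set X) :
  hausdorff_space X -> mb_C n U (@idfun X).
Proof. by move=> hX; apply: mb_C_linear => // x; exact: cvg_id. Qed.

Lemma mb_C_fst (n : nat) (X Y : tvsType R) (U : set (X * Y)) :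
  hausdorff_space X -> mb_C n U (fst : X * Y -> X).
Proof. by move=> hX; apply: mb_C_linear => // x; exact: cvg_fst. Qed.

Lemma mb_C_snd (n : nat) (X Y : tvsType R) (U : set (X * Y)) :
  hausdorff_space Y -> mb_C n U (snd : X * Y -> Y).
Proof. by move=> hX; apply: mb_C_linear => // x; exact: cvg_snd. Qed.

Lemma is_tvs_derive_pair (X Y Z : tvsType R) (f : X -> Y) (g : X -> Z) (x v : X)
    (k : Y) (l : Z) : is_tvs_derive f x v k -> is_tvs_derive g x v l ->
  is_tvs_derive (fun x => (f x, g x)) x v (k, l).
Proof. by move=> fk gl; exact: cvg_pair fk gl. Qed.

Lemma mb_C_pair (n : nat) (X Y Z : tvsType R) (U : set X) (f : X -> Y)
    (g : X -> Z) : hausdorff_space Y -> hausdorff_space Z -> open U ->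
  mb_C n U f -> mb_C n U g -> mb_C n U (fun x => (f x, g x)).
Proof.
move=> hY hZ; elim: n X U f g => [|n IH] X U f g oU.
  move=> /mb_C0P cf /mb_C0P cg; apply/mb_C0P => x Ux.
  by apply: cvg_pair; [exact: cf|exact: cg].
move=> [cf df Cdf] [cg dg Cdg]; split.
- by move=> x Ux; apply: cvg_pair; [exact: cf|exact: cg].
- move=> x v Ux; have [k dk] := df x v Ux; have [l dl] := dg x v Ux.
  by exists (k, l); exact: is_tvs_derive_pair.
have oU2 : open (U `*` [set: X]) by apply: open_setX => //; exact: openT.
have := IH _ _ _ _ oU2 Cdf Cdg; apply: mb_C_eq => // -[x v] [/= Ux _].
symmetry; apply: is_tvs_derive_unique; first exact: hausdorff_prod.
by apply: is_tvs_derive_pair; apply: tvs_deriveP; [exact: df|exact: dg].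
Qed.

Lemma mb_C_comp (n : nat) (X Y Z : tvsType R) (U : set X) (V : set Y)
    (f : X -> Y) (g : Y -> Z) : hausdorff_space X -> hausdorff_space Y ->
  hausdorff_space Z -> open U -> open V -> (forall x, U x -> V (f x)) ->
  mb_C n U f -> mb_C n V g -> mb_C n U (g \o f).
Proof.
elim: n X Y Z U V f g => [|n IH] X Y Z U V f g hX hY hZ oU oV UV.
  move=> /mb_C0P cf /mb_C0P cg; apply/mb_C0P => x Ux.
  by apply: continuous_comp; [exact: cf|apply: cg; exact: UV].
move=> Cf Cg; have [cf df Cdf] := Cf; have [cg dg Cdg] := Cg.
have Cg1 : mb_C 1 V g by split=> //; apply/mb_C0P; exact: mb_C_continuous Cdg.
have chain x v : U x ->
    is_tvs_derive (g \o f) x v (tvs_derive g (f x) (tvs_derive f x v)).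
  move=> Ux; apply: is_tvs_derive_comp Cg1 _ _ => //; first exact: UV.
  by apply: tvs_deriveP; exact: df.
split.
- move=> x Ux; apply: continuous_comp; first exact: cf.
  by apply: cg; move: Ux; rewrite !inE; exact: UV.
- by move=> x v Ux; eexists; exact: chain.
have oU2 : open (U `*` [set: X]) by apply: open_setX => //; exact: openT.
have oV2 : open (V `*` [set: Y]) by apply: open_setX => //; exact: openT.
(* By the chain rule the derivative of [g \o f] is dg composed with (x, v) |-> (f x, df(x, v)). Both
   are C^n, so the induction hypothesis applies on the product spaces. *)
have H : mb_C n (U `*` [set: X])
    ((fun q : Y * Y => tvs_derive g q.1 q.2) \o
     (fun p : X * X => (f p.1, tvs_derive f p.1 p.2))).
  apply: (IH _ _ _ _ (V `*` setT)) => //; try exact: hausdorff_prod.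
    by move=> [x v] [/= Ux _]; split=> //; exact: UV.
  apply: mb_C_pair => //.
  apply: (IH _ _ _ _ U fst f) => //; first exact: hausdorff_prod.
  - by move=> p [].
  - exact: mb_C_fst.
  - exact: mb_CW.
apply: mb_C_eq H => // -[x v] [/= Ux _].
by symmetry; apply: is_tvs_derive_unique => //; exact: chain.
Qed.

Lemma mb_C_comp_linear (n : nat) (X Y Z : tvsType R) (U : set X)
    (f : X -> Y) (L : Y -> Z) : hausdorff_space X -> hausdorff_space Y ->
  hausdorff_space Z -> open U -> linear L -> continuous L ->
  mb_C n U f -> mb_C n U (L \o f).
Proof.
move=> hX hY hZ oU linL cL Cf; apply: (mb_C_comp (V := setT)) Cf _ => //.
  exact: openT.
exact: mb_C_linear.
Qed.

Lemma mb_C_add (n : nat) (X Y : tvsType R) (U : set X) (f g : X -> Y) :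
  hausdorff_space X -> hausdorff_space Y -> open U ->
  mb_C n U f -> mb_C n U g -> mb_C n U (fun x => f x + g x).
Proof.
move=> hX hY oU Cf Cg.
apply: (mb_C_comp_linear (f := fun x => (f x, g x))
  (L := fun p : Y * Y => p.1 + p.2)) => //.
- exact: hausdorff_prod.
- by move=> a p q /=; rewrite scalerDr addrACA.
- exact: add_continuous.
- exact: mb_C_pair.
Qed.

Lemma mb_C_opp (n : nat) (X Y : tvsType R) (U : set X) (f : X -> Y) :
  hausdorff_space X -> hausdorff_space Y -> open U ->
  mb_C n U f -> mb_C n U (fun x => - f x).
Proof.
move=> hX hY oU Cf; apply: (mb_C_comp_linear (f := f) (L := -%R)) => //.
  by move=> a x y; rewrite opprD scalerN.
exact: opp_continuous.
Qed.

End mb_calculus.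

(** * Fixed points depending smoothly on a parameter *)

Section parametrized_fixed_point.
Context (R : realType) (B : completeNormedModType R).

Let hB : hausdorff_space B := @norm_hausdorff R B.

Lemma half_contraction_fixpoint (A : set B) (g : B -> B) (b0 : B) : closed A ->
  A b0 -> (forall b, A b -> A (g b)) ->
  (forall b c, A b -> A c -> `|g b - g c| <= 2^-1 * `|b - c|) ->
  exists2 b, A b & b = g b.
Proof.
move=> cA Ab0 gA lg.
have gF : isFun _ _ A A g by constructor.
pose G : {fun A >-> A} := HB.pack g gF.
have [|||b Ab gb] := @banach_fixed_point R B A G; last by exists b.
- have h0 : 0 <= 2^-1 :> R by rewrite invr_ge0.
  exists (NngNum h0); split; first by rewrite /= invf_lt1 // ltr1n.
  by move=> [b c] [/= Ab Ac]; exact: lg.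
- exact: cA.
- by exists b0.
Qed.

(** Only the Banach variable is measured, as P carries no norm; the constant 1/2 is the same on all
    fibres. *)
Definition fibre_contraction (P : tvsType R) (O : set (P * B))
    (h : P * B -> B) :=
  forall z b c, O (z, b) -> O (z, c) ->
    `|h (z, b) - h (z, c)| <= 2^-1 * `|b - c|.

(** A posteriori estimate for a contraction: if [a] is a fixed point and [b] the image of [c], the
    distance from [c] to [a] is at most twice the defect of [c]. *)
Lemma le_half_fixed (a b c : B) :
  `|a - b| <= 2^-1 * `|a - c| -> `|a - c| <= 2 * `|b - c|.
Proof.
move=> H; have := ler_distD b a c; lra.
Qed.

(** For z near z0 the old value u z0 is almost fixed by h(z, .), with defect |h(z, u z0) - u z0|
    tending to 0; twice this defect bounds |u z - u z0|. *)
Lemma fixed_point_continuous (P : tvsType R) (O : set (P * B)) (h : P * B -> B)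
    (U : set P) (u : P -> B) : open O -> mb_C 0 O h -> fibre_contraction O h ->
  open U -> (forall z, U z -> O (z, u z) /\ u z = h (z, u z)) ->
  mb_C 0 U u.
Proof.
move=> oO /mb_C0P ch fh oU Uu; apply/mb_C0P => z0 Uz0.
have [Oz0 uz0] := Uu z0 Uz0.
have cz : (z, u z0) @[z --> z0] --> (z0, u z0).
  by apply: cvg_pair; [exact: cvg_id|exact: cvg_cst].
have nO : \forall z \near z0, O (z, u z0).
  by apply: cz; exact: open_nbhs_nbhs.
have nU : \forall z \near z0, U z by exact: open_nbhs_nbhs.
have ch0 : h (z, u z0) @[z --> z0] --> u z0.
  by rewrite [X in _ --> X]uz0; apply: (cvg_comp _ _ cz); exact: ch.
apply/cvgrPdist_lt => e e0.
have e2 : 0 < e / 2 by rewrite divr_gt0.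
move/cvgrPdist_lt : ch0 => /(_ _ e2); apply: filterS3 nO nU => z Oz Uz hz.
rewrite distrC; apply: (@le_lt_trans _ _ (2 * `|h (z, u z0) - u z0|)).
  have [Ozu uz] := Uu z Uz.
  by apply: le_half_fixed; rewrite [X in `|X - _|]uz; exact: fh.
by rewrite distrC; lra.
Qed.

(** Differentiating u z = h(z, u z) in direction w gives v = dh((z, u z), (w, v)), a fixed point
    equation in v with parameter (z, w) and the same contraction constant. Its solution D is the
    derivative of u, and D is C^n by the induction hypothesis, which is therefore stated for all
    parameter spaces. *)
Lemma fixed_point_mb_C (n : nat) (P : tvsType R) (O : set (P * B))
    (h : P * B -> B) (U : set P) (u : P -> B) : hausdorff_space P ->
  open O -> mb_C n O h -> fibre_contraction O h ->
  open U -> (forall z, U z -> O (z, u z) /\ u z = h (z, u z)) ->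
  mb_C n U u.
Proof.
elim: n P O h U u => [|n IH] P O h U u hP oO hC fh oU Uu.
  exact: (fixed_point_continuous oO hC fh oU Uu).
(* The equation for the derivative involves [u] itself, so the lower regularity of [u] comes
   first. *)
have uC : mb_C n U u by apply: IH oO (mb_CW hC) fh oU Uu.
have [ch dh Cdh] := hC.
pose dh' (p : (P * P) * B) := tvs_derive h (p.1.1, u p.1.1) (p.1.2, p.2).
have nO z (w : P * B) : U z ->
    \forall t \near (0 : R)^', O (t *: w + (z, u z)).
  move=> Uz; have [Oz _] := Uu z Uz.
  have := @line_cvg _ _ (z, u z) w _ (open_nbhs_nbhs (conj oO Oz)).
  by [].
(* The Lipschitz bound of [h] on fibres passes to difference quotients and then to their limits. *)
have dlip z w b c : U z -> `|dh' ((z, w), b) - dh' ((z, w), c)| <=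
    2^-1 * `|b - c|.
  move=> Uz; have [Oz uz] := Uu z Uz.
  have Hb := tvs_deriveP (dh _ (w, b) Oz).
  have Hc := tvs_deriveP (dh _ (w, c) Oz).
  apply: (cvgr_to_le (cvg_norm (tvs_cvgB Hb Hc))).
  apply: filterS3 (nbhs_dnbhs_neq (0 : R)) (nO z (w, b) Uz) (nO z (w, c) Uz).
  move=> t t0 Ob Oc; rewrite -scalerBr opprB addrA subrK normrZ normfV.
  rewrite ler_pdivrMl ?normr_gt0 //; apply: (le_trans (fh _ _ _ Ob Oc)).
  rewrite mulrCA ler_pM2l ?invr_gt0 //= opprD addrACA subrr addr0.
  by rewrite -scalerBr normrZ.
pose D (p : P * P) : B := xget 0 [set v | v = dh' (p, v)].
have DE z w : U z -> D (z, w) = dh' ((z, w), D (z, w)).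
  move=> Uz; apply: (@xgetPex B 0 [set v | v = dh' ((z, w), v)]).
  have [|||v _ vE] :=
    @half_contraction_fixpoint setT (fun v => dh' ((z, w), v)) 0 closedT.
  - by [].
  - by [].
  - by move=> b c _ _; exact: dlip.
  by exists v.
(* For small t the quotient [q] of [u] satisfies |q - a| <= |q - v| / 2, where [a] is the quotient
   of [h] in direction (w, v). As [a] tends to [v], so does [q]. *)
have du z w : U z -> is_tvs_derive u z w (D (z, w)).
  move=> Uz; have [Oz uz] := Uu z Uz; set v := D (z, w).
  have Ha := tvs_deriveP (dh _ (w, v) Oz).
  rewrite -[tvs_derive _ _ _]/(dh' ((z, w), v)) -DE // -/v in Ha.
  apply/cvgrPdist_lt => e e0; have e2 : 0 < e / 2 by rewrite divr_gt0.
  move/cvgrPdist_lt : Ha => /(_ _ e2) Ha.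
  have nU : \forall t \near (0 : R)^', U (t *: w + z).
    exact: (@line_cvg _ _ z w _ (open_nbhs_nbhs (conj oU Uz))).
  have nt := nbhs_dnbhs_neq (0 : R).
  apply: filterS3 (filterI nt nU) (nO z (w, v) Uz) Ha => t [t0 Ut] Ot at_.
  have [Ozu uzt] := Uu _ Ut.
  set q := t^-1 *: _; set a := t^-1 *: (_ - _) in at_.
  rewrite distrC; apply: (@le_lt_trans _ _ (2 * `|a - v|)); last first.
    by rewrite distrC; lra.
  apply: le_half_fixed.
  have -> : q - v = t^-1 *: (u (t *: w + z) - u z - t *: v).
    by rewrite scalerBr scalerA mulVf // scale1r.
  rewrite /q /a -scalerBr !normrZ mulrCA ler_pM2l ?normr_gt0 ?invr_eq0 //.
  rewrite -uz opprB addrA subrK [X in `|X - _|]uzt.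
  apply: (le_trans (fh _ _ _ Ozu Ot)) => /=.
  by rewrite opprD addrA [_ - u z]addrAC.
have oU2 : open (U `*` [set: P]) by apply: open_setX => //; exact: openT.
have oU3 : open ((U `*` [set: P]) `*` [set: B]) by exact: open_setX openT.
have hPP := hausdorff_prod hP hP; have hPPB := hausdorff_prod hPP hB.
have hPB := hausdorff_prod hP hB; have hPBPB := hausdorff_prod hPB hPB.
split.
- exact: (fixed_point_continuous oO ch fh oU Uu).
- by move=> z w Uz; eexists; exact: du.
have DC : mb_C n (U `*` [set: P]) D.
  apply: (IH _ ((U `*` setT) `*` setT) dh').
  - exact: hausdorff_prod.
  - by apply: open_setX => //; exact: openT.
  - apply: (mb_C_comp (V := O `*` setT)
      (f := fun p : (P * P) * B => ((p.1.1, u p.1.1), (p.1.2, p.2)))) Cdh => //.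
    + exact: open_setX openT.
    + by move=> [[z w] b] [[/= Uz _] _]; split=> //; have [] := Uu z Uz.
    + have c11 : mb_C n ((U `*` setT) `*` setT)
          ((fst : P * P -> P) \o (fst : (P * P) * B -> P * P)).
        apply: mb_C_comp_linear => //.
          by move=> p; exact: cvg_fst.
        exact: mb_C_fst.
      apply: mb_C_pair => //.
      * apply: mb_C_pair => //.
        by apply: (mb_C_comp (V := U) (f := fst \o fst)) uC => // -[p b] [[]].
      * apply: mb_C_pair => //; last exact: mb_C_snd.
        apply: (mb_C_comp_linear (L := snd) (f := fst)) => //.
          by move=> p; exact: cvg_snd.
        exact: mb_C_fst.
  - by move=> [z w] b c [[/= Uz _] _] _; exact: dlip.
  - exact: oU2.
  - by move=> [z w] [/= Uz _]; split=> //; exact: DE.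
apply: mb_C_eq DC => // -[z w] [/= Uz _].
by symmetry; apply: is_tvs_derive_unique => //; exact: du.
Qed.

Lemma norm_lt_convex (r : R) : convex_subset [set b : B | `|b| < r].
Proof.
move=> a b t t0 t1 /= ar br.
apply: (le_lt_trans (ler_normD _ _)); rewrite !normrZ !ger0_norm ?subr_ge0 //.
have [->|tn0] := eqVneq t 0; first by rewrite mul0r add0r subr0 mul1r.
have tp : 0 < t by rewrite lt_neqAle eq_sym tn0.
have : t * `|a| < t * r by rewrite ltr_pM2l.
have : (1 - t) * `|b| <= (1 - t) * r by rewrite ler_wpM2l ?subr_ge0 // ltW.
lra.
Qed.

Lemma open_norm_lt (r : R) : open [set b : B | `|b| < r].
Proof.
apply: (@open_comp _ _ (fun b : B => `|b|) [set x | x < r]).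
  by move=> b _; exact: norm_continuous.
exact: open_lt.
Qed.

Lemma nbhs0_norm_lt (A : set B) :
  nbhs (0 : B) A -> exists2 r : R, 0 < r & forall b, `|b| < r -> A b.
Proof.
move=> /nbhs_normP[r r0 rA]; exists r => // b br; apply: rA.
by rewrite /ball_ /= sub0r normrN.
Qed.

(** Joint continuity of dh bounds it over a sphere of B but does not make the bound small. The
    second derivative does: strict differentiability of Dh at the origin gives |Dh((t z, t b), (0,
    v))| < t for all small z, b, v and t > 0. Homogeneity in v and the mean value lemma turn this
    into a contraction. *)
Lemma flat_fibre_contraction (P : tvsType R) (O : set (P * B))
    (h : P * B -> B) : hausdorff_space P -> open O -> O (0, 0) -> mb_C 2 O h ->
  (forall v, tvs_derive h (0, 0) v = 0) ->
  exists (A : set P) (r : R), [/\ nbhs 0 A, 0 < r &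
    fibre_contraction (A `*` [set b | `|b| < r]) h] /\
    A `*` [set b | `|b| < r] `<=` O.
Proof.
move=> hP oO O0 hC h0; have [ch dh Cdh] := hC.
have h1 : mb_C 1 O h by exact: mb_CW.
pose Dh (q : (P * B) * (P * B)) := tvs_derive h q.1 q.2.
have {}Cdh : mb_C 1 (O `*` [set: P * B]) Dh by [].
have oO2 : open (O `*` [set: P * B]) by exact: open_setX openT.
have OO : (O `*` [set: P * B]) ((0, 0), (0, 0)) by [].
have D0 : tvs_derive Dh ((0, 0), (0, 0)) ((0, 0), (0, 0)) = 0.
  have := tvs_derive_scale ((0, 0), (0, 0)) 0 hB oO2 Cdh OO.
  by rewrite !scale0r.
have K0 : nbhs (tvs_derive Dh ((0, 0), (0, 0)) ((0, 0), (0, 0)))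
    [set b : B | `|b| < 1].
  rewrite D0; apply/nbhs_normP; exists 1 => //= b.
  by rewrite /ball_ /= sub0r normrN.
have H := strict_derive oO2 Cdh OO K0.
(* For p = (((z, b), v), t): base point ((0, 0), (0, v)), at which [Dh] vanishes, and direction ((z,
   b), (0, 0)). *)
pose phi (p : ((P * B) * B) * R) :
    (((P * B) * (P * B)) * ((P * B) * (P * B))) * R :=
  ((((0, 0), (0, p.1.2)), (p.1.1, (0, 0))), p.2).
have cphi : phi p @[p --> (((0, 0), 0), 0 : R)] -->
    ((((0, 0), (0, 0)), ((0, 0), (0, 0))), 0 : R).
  have c2 : (p : ((P * B) * B) * R).2 @[p --> (((0, 0), 0), 0 : R)] --> (0 : R).
    exact: cvg_snd.
  have c12 : (p : ((P * B) * B) * R).1.2 @[p --> (((0, 0), 0), 0 : R)]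
      --> (0 : B).
    by apply: (cvg_comp _ _ cvg_fst); exact: cvg_snd.
  have c11 : (p : ((P * B) * B) * R).1.1 @[p --> (((0, 0), 0), 0 : R)]
      --> ((0, 0) : P * B).
    by apply: (cvg_comp _ _ cvg_fst); exact: cvg_fst.
  have ca : ((0 : P), (p : ((P * B) * B) * R).1.2)
      @[p --> (((0, 0), 0), 0 : R)] --> ((0 : P), (0 : B)).
    exact: cvg_pair (cvg_cst _) c12.
  have cb : (((0, 0) : P * B), ((0 : P), (p : ((P * B) * B) * R).1.2))
      @[p --> (((0, 0), 0), 0 : R)] --> (((0, 0) : P * B), ((0, 0) : P * B)).
    exact: cvg_pair (cvg_cst _) ca.
  have cc : ((p : ((P * B) * B) * R).1.1, ((0, 0) : P * B))
      @[p --> (((0, 0), 0), 0 : R)] --> (((0, 0) : P * B), ((0, 0) : P * B)).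
    exact: cvg_pair c11 (cvg_cst _).
  exact: cvg_pair (cvg_pair cb cc) c2.
have := cphi _ H.
move=> [[N N3]] /= [[[N1 N2]] /= [[[A0 C0]] /= [nA0 nC0] AC nN2] NN nN3] sub.
have [[A1 C1] /= [nA1 nC1] ACO] := open_nbhs_nbhs (conj oO O0).
have [rho0 rho00 C0rho] := nbhs0_norm_lt nC0.
have [rho1 rho10 C1rho] := nbhs0_norm_lt nC1.
have [d d0 N2d] := nbhs0_norm_lt nN2.
have [e e0 N3e] : exists2 e : R, 0 < e & forall t, `|t| < e -> N3 t.
  have [e e0 eN] := (nbhs_ballP _ _).1 nN3; exists e => // t te.
  by apply: eN; rewrite /ball /= sub0r normrN.
(* A vector [v] of norm [d'] lies in [N2], and [t < e] is an admissible step; [t <= d' / 2] makes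
   the bound half the norm of [v]. *)
pose d' := d / 2; pose t := Num.min e d' / 2.
have d'0 : 0 < d' by rewrite divr_gt0.
have m0 : 0 < Num.min e d' by rewrite lt_min e0.
have t0 : 0 < t by rewrite divr_gt0.
have te : t < e.
  have : Num.min e d' <= e by rewrite ge_min lexx.
  by rewrite /t; lra.
have td : t <= d' / 2.
  by rewrite /t ler_pM2r ?invr_gt0 // ge_min lexx orbT.
(* [A] and [r] keep t^-1 z in [A0] and t^-1 b in [C0], besides keeping (z, b) in [O]. *)
pose A := A1 `&` (fun z => t^-1 *: z) @^-1` A0.
pose r := Num.min rho1 (t * rho0).
have Dsmall z b v : A z -> `|b| < r -> `|v| = d' ->
    `|Dh ((z, b), (0, v))| < d' / 2.
  move=> [_ /= Az] br vd.
  have bt : C0 (t^-1 *: b).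
    apply: C0rho; rewrite normrZ normfV (ger0_norm (ltW t0)) ltr_pdivrMl //.
    by move: br; rewrite lt_min => /andP[].
  have := sub (((t^-1 *: z, t^-1 *: b), v), t).
  rewrite /= gt_eqF //.
  rewrite normrZ normfV (ger0_norm (ltW t0)) ltr_pdivrMl // mulr1.
  have -> : t *: ((t^-1 *: z, t^-1 *: b), ((0, 0) : P * B)) +
      (((0, 0) : P * B), ((0, v) : P * B)) = ((z, b), ((0, v) : P * B)).
    transitivity ((t *: (t^-1 *: z) + 0, t *: (t^-1 *: b) + 0),
      ((t *: 0 + 0, t *: 0 + v) : P * B)); first by [].
    by rewrite !scaler0 !addr0 add0r !scalerA divff ?gt_eqF // !scale1r.
  rewrite /Dh /= h0 subr0 => H1; apply: lt_le_trans td; apply: H1 => //.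
  split; last by apply: N3e; rewrite ger0_norm // ltW.
  apply: NN; split=> /=; first by apply: AC.
  by apply: N2d; rewrite vd /d'; lra.
have Azb z b : A z -> `|b| < r -> O (z, b).
  move=> [Az _] br; apply: ACO; split=> //=; apply: C1rho.
  by move: br; rewrite lt_min => /andP[].
have Dhalf z b v : A z -> `|b| < r -> v != 0 ->
    `|Dh ((z, b), (0, v))| < 2^-1 * `|v|.
  move=> Az br v0; have vp : 0 < `|v| by rewrite normr_gt0.
  pose s := d' / `|v|; have s0 : 0 < s by rewrite divr_gt0.
  have := Dsmall z b (s *: v) Az br.
  rewrite normrZ (ger0_norm (ltW s0)) divfK ?gt_eqF // => /(_ erefl).
  have -> : ((0, s *: v) : P * B) = s *: ((0, v) : P * B).
    by transitivity ((s *: 0, s *: v) : P * B); first by rewrite scaler0.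
  rewrite /Dh /= (tvs_derive_scale _ _ hB oO h1 (Azb _ _ Az br)).
  rewrite normrZ (ger0_norm (ltW s0)) /s mulrAC ltr_pdivrMr //.
  by rewrite -(mulrA d') ltr_pM2l.
exists A, r; split; last by move=> [z b] [/= Az br]; exact: Azb.
split.
- apply: filterI => //.
  have c : (t^-1 *: z) @[z --> (0 : P)] --> (0 : P).
    rewrite -[X in _ --> X](scaler0 _ t^-1).
    exact: tvs_cvgZ (cvg_cst _) cvg_id.
  exact: c.
- by rewrite lt_min rho10 mulr_gt0.
move=> z b c [/= Az br] [_ /= cr].
have [->|bc] := eqVneq b c; first by rewrite !subrr normr0 mulr0.
have bc0 : b - c != 0 by rewrite subr_eq0.
apply: ltW.
have := @mean_value_convex R B _ (fun s => h (s *: (0, b - c) + (z, c))) 0 1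
  (@norm_lt_convex (2^-1 * `|b - c|)) ltr01.
rewrite subr0 invr1 scale1r scale1r scale0r add0r /=.
have -> : ((0, b - c) : P * B) + (z, c) = (z, b).
  by transitivity ((0 + z, b - c + c) : P * B); last rewrite add0r subrK.
apply => s /andP[s0 s1].
pose w : P * B := s *: (0, b - c) + (z, c).
have wE : w = (z, s *: b + (1 - s) *: c).
  transitivity ((s *: 0 + z, s *: (b - c) + c) : P * B); first by [].
  by rewrite scaler0 add0r scalerBr scalerBl scale1r -addrA [- _ + c]addrC.
have wr : `|s *: b + (1 - s) *: c| < r by exact: norm_lt_convex.
have Ow : O w by rewrite wE; exact: Azb.
exists (tvs_derive h w (0, b - c)).
  apply: open_nbhs_nbhs; split; last by rewrite wE; exact: (Dhalf _ _ _ Az wr).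
  exact: open_norm_lt.
apply: (cvg_near_eq (tvs_deriveP (dh _ (0, b - c) Ow))); apply: nearW => x /=.
by rewrite /w addrA -scalerDl [x + s]addrC.
Qed.

(** On W the value h(z, 0) has norm below r / 4, so h(z, .) maps the closed ball of radius r / 2
    into itself: r / 4 + r / 4 = r / 2. The fixed point found there is unique in the whole open ball
    of radius r. *)
Lemma smooth_fixed_point (P : tvsType R) (O : set (P * B)) (h : P * B -> B) :
  hausdorff_space P -> open O -> O (0, 0) -> mb_smooth O h -> h (0, 0) = 0 ->
  (forall v, tvs_derive h (0, 0) v = 0) ->
  exists (W : set P) (r : R) (u : P -> B),
    [/\ open W, W 0, 0 < r & mb_smooth W u] /\
    [/\ forall z b, W z -> `|b| < r -> O (z, b),
        forall z, W z -> `|u z| < r /\ u z = h (z, u z) &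
        forall z b, W z -> `|b| < r -> b = h (z, b) -> b = u z].
Proof.
move=> hP oO O0 hC h00 dh0.
have [A [r [[nA r0 fh] AO]]] := flat_fibre_contraction hP oO O0 (hC 2%N) dh0.
have hc : h (z, 0) @[z --> (0 : P)] --> (0 : B).
  rewrite -[X in _ --> X]h00.
  apply: (cvg_comp (fun z => (z, 0)) h (G := nbhs ((0, 0) : P * B))).
    exact: cvg_pair cvg_id (cvg_cst _).
  exact: (mb_C_continuous (hC 0%N)).
have r4 : 0 < r / 4 by rewrite divr_gt0.
have nh : \forall z \near (0 : P), `|h (z, 0)| < r / 4.
  exact: (cvgr0_norm_lt _ hc _ r4).
have [W [oW W0] WA] : exists2 W, open_nbhs (0 : P) W &
    W `<=` A `&` [set z | `|h (z, 0)| < r / 4].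
  have : nbhs (0 : P) (A `&` [set z | `|h (z, 0)| < r / 4]) by exact: filterI.
  by rewrite nbhsE.
have Wr z (b : B) : W z -> `|b| < r -> (A `*` [set b | `|b| < r]) (z, b).
  by move=> /WA[].
have r0r : `|0 : B| < r by rewrite normr0.
have ex z : W z -> exists2 b, `|b| < r & b = h (z, b).
  move=> Wz; have [_ /= hz] := WA z Wz.
  have lt_r (b : B) : `|b| <= r / 2 -> `|b| < r by move=> ?; lra.
  pose C := closed_ball_ (fun x : B => `|x|) 0 (r / 2).
  have CE b : C b -> `|b| <= r / 2 by rewrite /C /closed_ball_ /= sub0r normrN.
  have [||||b Cb bE] := @half_contraction_fixpoint C (fun b => h (z, b)) 0.
  - exact: closed_closed_ball_.
  - by rewrite /C /closed_ball_ /= subrr normr0 divr_ge0 // ltW.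
  - move=> b /CE br; rewrite /C /closed_ball_ /= sub0r normrN.
    have := fh z b 0 (Wr _ _ Wz (lt_r _ br)) (Wr _ _ Wz r0r).
    rewrite subr0 => H.
    have := ler_normD (h (z, b) - h (z, 0)) (h (z, 0)); rewrite subrK.
    lra.
  - move=> b c /CE br /CE cr.
    exact: fh (Wr _ _ Wz (lt_r _ br)) (Wr _ _ Wz (lt_r _ cr)).
  by exists b => //; apply: lt_r; exact: CE.
pose u z := xget 0 [set b | `|b| < r /\ b = h (z, b)].
have uP z : W z -> `|u z| < r /\ u z = h (z, u z).
  move=> Wz; have [b br bE] := ex z Wz.
  by apply: (@xgetPex B 0 [set b | `|b| < r /\ b = h (z, b)]); exists b.
exists W, r, u; split.
  split=> // n.
  apply: (@fixed_point_mb_C n P (W `*` [set b | `|b| < r]) h) => //.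
  - by apply: open_setX => //; exact: open_norm_lt.
  - by apply: mb_C_sub (hC n) => -[z b] [/= Wz br]; apply: AO; exact: Wr.
  - move=> z b c [/= Wz br] [_ /= cr].
    exact: fh (Wr _ _ Wz br) (Wr _ _ Wz cr).
  - by move=> z Wz; have [ur uE] := uP z Wz.
split=> //.
- by move=> z b Wz br; apply: AO; exact: Wr.
move=> z b Wz br bE; have [ur uE] := uP z Wz.
have := fh z b (u z) (Wr _ _ Wz br) (Wr _ _ Wz ur).
rewrite -bE -uE => H; apply/eqP; rewrite -subr_eq0 -normr_le0.
have := normr_ge0 (b - u z); lra.
Qed.

End parametrized_fixed_point.

(** * Regular operators and generalized inverses *)

Section regular_operators.
Context (R : realType).

(** The difference pr1 x - a = b - pr2 x lies in both summands. *)
Lemma decomposition_unique (X : tvsType R) (D : decomposition X) (a b : X) :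
  summand1 D a -> summand2 D b -> pr1 D (a + b) = a /\ pr2 D (a + b) = b.
Proof.
move=> Da Db; set x := a + b.
have [_ S1] := summand1_subspace D; have [_ S2] := summand2_subspace D.
have e : pr1 D x - a = b - pr2 D x.
  by apply/eqP; rewrite subr_eq addrAC eq_sym subr_eq pr_add addrC.
have e0 : (summand1 D `&` summand2 D) (pr1 D x - a).
  split.
    by rewrite addrC -scaleN1r; apply: S1 => //; exact: pr1_in.
  by rewrite e addrC -scaleN1r; apply: S2 => //; exact: pr2_in.
rewrite summand_disjoint /= in e0.
split; first by apply/eqP; rewrite -subr_eq0 e0.
by apply/esym/eqP; rewrite -subr_eq0 -e e0.
Qed.

(** Linearity of the projections is not a field of [decomposition]; it follows from the uniqueness
    of components. *)
Lemma pr_linear (X : tvsType R) (D : decomposition X) :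
  linear (pr1 D) /\ linear (pr2 D).
Proof.
have [_ S1] := summand1_subspace D; have [_ S2] := summand2_subspace D.
have H k x y : pr1 D (k *: x + y) = k *: pr1 D x + pr1 D y /\
    pr2 D (k *: x + y) = k *: pr2 D x + pr2 D y.
  have -> : k *: x + y =
      (k *: pr1 D x + pr1 D y) + (k *: pr2 D x + pr2 D y).
    by rewrite addrACA -scalerDr !pr_add.
  by apply: decomposition_unique; [apply: S1|apply: S2];
    by [exact: pr1_in|exact: pr2_in].
by split=> k x y; have [] := H k x y.
Qed.

Lemma pr_summand1 (X : tvsType R) (D : decomposition X) (x : X) :
  summand1 D x -> pr1 D x = x /\ pr2 D x = 0.
Proof.
move=> Dx; have [S20 _] := summand2_subspace D.
by have := decomposition_unique Dx S20; rewrite addr0.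
Qed.

Lemma pr2_id (X : tvsType R) (D : decomposition X) (x : X) :
  summand2 D x -> pr2 D x = x.
Proof.
move=> Dx; have [S10 _] := summand1_subspace D.
by have := decomposition_unique S10 Dx; rewrite add0r => -[].
Qed.

(** * Decompositions defined by continuous linear idempotents *)

Section projection.
Context (X : tvsType R) (E : X -> X) (linE : linear E) (cE : continuous E)
  (idemE : forall x, E (E x) = E x).

Let E0 : E 0 = 0.
Proof. by have := linE (-1) 0 0; rewrite scaler0 addr0 scaleN1r addNr. Qed.

Let ker_subspace : linear_subspace [set x | E x = 0].
Proof.
split=> [|a x y /= x0 y0]; first exact: E0.
by rewrite linE x0 y0 scaler0 addr0.
Qed.

Let fix_subspace : linear_subspace [set x | E x = x].
Proof.
split=> [|a x y /= x0 y0]; first exact: E0.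
by rewrite linE x0 y0.
Qed.

Let ker_fix : [set x | E x = 0] `&` [set x | E x = x] = [set 0].
Proof.
apply/seteqP; split=> x /=; first by move=> [-> <-].
by move=> ->; rewrite E0.
Qed.

Let ker_in x : E (x - E x) = 0.
Proof.
have := linE (-1) (E x) x; rewrite !scaleN1r idemE addNr.
by rewrite addrC.
Qed.

Let ker_fix_add x : x - E x + E x = x.
Proof. by rewrite subrK. Qed.

Let ker_continuous : continuous (fun x => x - E x).
Proof.
by move=> x; apply: tvs_cvgB; [exact: cvg_id|exact: cE].
Qed.

(** The kernel of E comes first and its image second, matching ker and coim for E = S T, and coker
    and im for E = T S. *)
Definition projection_decomposition : decomposition X :=
  @Decomposition R X _ _ (fun x => x - E x) E ker_subspace fix_subspace ker_fix
    ker_in idemE ker_fix_add ker_continuous cE.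

End projection.

Lemma kernel_closed (X Y : tvsType R) (T : X -> Y) : hausdorff_space Y ->
  continuous T -> closed (T @^-1` [set 0]).
Proof.
move=> hY cT; apply: closed_comp; first by move=> x _; exact: cT.
exact/accessible_closed_set1/hausdorff_accessible.
Qed.

Definition generalized_inverse (X Y : tvsType R) (T : X -> Y) (S : Y -> X) :=
  [/\ linear S, continuous S, forall x, T (S (T x)) = T x &
      forall y, S (T (S y)) = S y].

Lemma open_addr (X : tvsType R) (U : set X) (k : X) :
  open U -> open [set x | U (x + k)].
Proof.
have c : continuous (fun x : X => x + k).
  by move=> x; apply: tvs_cvgD; [exact: cvg_id|exact: cvg_cst].
by move/continuousP : c => c oU; exact: c.
Qed.

Lemma linear_map0 (X Y : lmodType R) (T : X -> Y) : linear T -> T 0 = 0.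
Proof.
by move=> linT; have := linT (-1) 0 0; rewrite scaler0 addr0 scaleN1r addNr.
Qed.

Lemma linear_mapB (X Y : lmodType R) (T : X -> Y) (x y : X) : linear T ->
  T (x - y) = T x - T y.
Proof.
by move=> linT; rewrite -scaleN1r addrC linT scaleN1r addrC.
Qed.

Lemma linear_mapD (X Y : lmodType R) (T : X -> Y) (x y : X) : linear T ->
  T (x + y) = T x + T y.
Proof. by move=> linT; rewrite -[x in LHS]scale1r linT scale1r. Qed.

(** T and S T have the same kernel, and the image of T is the kernel of 1 - T S; both are
    complemented by means of idempotents. For relative openness, a point y of the range lies in T(U)
    exactly when S y lies in U + ker T. *)
Lemma generalized_inverse_regular (X Y : tvsType R) (T : X -> Y) (S : Y -> X) :
  hausdorff_space Y -> linear T -> continuous T -> linear S -> continuous S ->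
  (forall x, T (S (T x)) = T x) -> regular_operator T.
Proof.
move=> hY linT cT linS cS TST.
have linST : linear (S \o T) by move=> a x y /=; rewrite linT linS.
have cST : continuous (S \o T).
  by move=> x; apply: continuous_comp; [exact: cT|exact: cS].
have kerE : T @^-1` [set 0] = [set x | (S \o T) x = 0].
  apply/seteqP; split=> x /= Tx; first by rewrite Tx (linear_map0 linS).
  by rewrite -TST Tx (linear_map0 linT).
pose E y := y - T (S y).
have linE : linear E.
  by move=> a x y; rewrite /E linS linT scalerBr opprD addrACA.
have cE : continuous E.
  move=> y; apply: tvs_cvgB; first exact: cvg_id.
  by apply: (@continuous_comp _ _ _ S T); [exact: cS|exact: cT].
have imE : range T = E @^-1` [set 0].
  apply/seteqP; split=> y /=; first by move=> [x _ <-]; rewrite /E TST subrr.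
  by move=> /subr0_eq ->; exists (S y).
have idemE y : E (E y) = E y.
  rewrite {1}/E; have -> : T (S (E y)) = 0; last by rewrite subr0.
  by rewrite /E (linear_mapB _ _ linS) (linear_mapB _ _ linT) TST subrr.
split=> //.
- move=> U oU; exists (S @^-1` [set x | exists2 k, T k = 0 & U (x + k)]).
    move/continuousP : cS; apply.
    have -> : [set x | exists2 k, T k = 0 & U (x + k)] =
        \bigcup_(k in [set k | T k = 0]) [set x | U (x + k)].
      by apply/seteqP; split=> x [k ? ?]; exists k.
    by apply: bigcup_open => k _; exact: open_addr.
  apply/seteqP; split=> y /=.
    move=> [x Ux <-]; split; last by exists x.
    exists (x - S (T x)); last by rewrite addrC subrK.
    by rewrite (linear_mapB _ _ linT) TST subrr.
  move=> [[k Tk0 Uk] [x _ xy]]; exists (S y + k) => //.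
  by have := linT 1 (S y) k; rewrite !scale1r => ->; rewrite Tk0 addr0 -xy TST.
- exact: kernel_closed.
- exists (projection_decomposition linST cST (fun x => congr1 S (TST x))).
  by rewrite kerE.
- by rewrite imE; exact: kernel_closed.
- by rewrite imE; exists (projection_decomposition linE cE idemE).
Qed.

(** S y is the coim component of any preimage of the im component of y. Two preimages differ by an
    element of ker T, so the choice made by [xget] is immaterial. *)
Lemma regular_generalized_inverse (X Y : tvsType R) (T : X -> Y) :
  regular_operator T -> exists S, generalized_inverse T S.
Proof.
move=> [linT cT opT _ [D1 D1E] _ [D2 D2E]].
have [_ lin2] := pr_linear D1; have [lin1 _] := pr_linear D2.
pose S y := pr2 D1 (xget 0 [set x | T x = pr1 D2 y]).
have Sex y : T (xget 0 [set x | T x = pr1 D2 y]) = pr1 D2 y.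
  have : range T (pr1 D2 y) by rewrite -D2E; exact: pr1_in.
  move=> [x _ xy].
  by apply: (@xgetPex X 0 [set x | T x = pr1 D2 y]); exists x.
have pr2E x x' : T x = T x' -> pr2 D1 x = pr2 D1 x'.
  move=> xx'; apply/eqP; rewrite -subr_eq0 -(linear_mapB _ _ lin2); apply/eqP.
  by apply: (pr_summand1 _).2; rewrite D1E /= (linear_mapB _ _ linT) xx' subrr.
have Tpr2 x : T (pr2 D1 x) = T x.
  have {2}-> : x = 1 *: pr1 D1 x + pr2 D1 x by rewrite scale1r pr_add.
  rewrite linT; have : summand1 D1 (pr1 D1 x) by exact: pr1_in.
  by rewrite D1E /= => ->; rewrite scaler0 add0r.
have SE x y : T x = pr1 D2 y -> S y = pr2 D1 x.
  by move=> xy; apply: pr2E; rewrite Sex.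
have TS y : T (S y) = pr1 D2 y by rewrite /S Tpr2 Sex.
have prT x : pr1 D2 (T x) = T x.
  by apply: (pr_summand1 _).1; rewrite D2E; exists x.
have ST x : S (T x) = pr2 D1 x by apply: SE; rewrite prT.
exists S; split.
- move=> a y z; rewrite -lin2; apply: SE.
  by rewrite linT !Sex lin1.
(* Relative openness provides V whose trace on the range is T(pr2^-1(O)); then S^-1(O) is the
   preimage of V under the projection onto the range. *)
- apply/continuousP => O oO.
  have [V oV VE] := opT _ ((continuousP _).1 (@pr2_continuous _ _ D1) O oO).
  have -> : S @^-1` O = pr1 D2 @^-1` V.
    apply/seteqP; split=> y /=.
      move=> Oy; have : (T @` (pr2 D1 @^-1` O)) (pr1 D2 y).
        by exists (xget 0 [set x | T x = pr1 D2 y]).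
      by rewrite VE => -[].
    move=> Vy; have : (T @` (pr2 D1 @^-1` O)) (pr1 D2 y).
      by rewrite VE; split=> //; rewrite -D2E; exact: pr1_in.
    by move=> [x /= Ox xy]; rewrite (SE x).
  exact: (continuousP _).1 (@pr1_continuous _ _ D2) V oV.
- by move=> x; rewrite TS prT.
- by move=> y; rewrite ST /S; apply: pr2E; rewrite Tpr2.
Qed.

End regular_operators.

(** * Finite-dimensional targets *)

Section finite_dimension.
Context (R : realType).

Lemma tvs_cvg_sum (X : tvsType R) (T I : Type) (F : set_system T)
    {FF : Filter F} (s : seq I) (f : I -> T -> X) (a : I -> X) :
  (forall i, f i @ F --> a i) ->
  (\sum_(i <- s) f i x) @[x --> F] --> \sum_(i <- s) a i.
Proof.
move=> fa; elim: s => [|i s IH].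
  by rewrite big_nil; under eq_fun do rewrite big_nil; exact: cvg_cst.
rewrite big_cons; under eq_fun do rewrite big_cons.
exact: tvs_cvgD.
Qed.

Lemma row_linear_continuous (X : tvsType R) (n : nat) (psi : 'rV[R]_n -> X) :
  linear psi -> continuous psi.
Proof.
move=> linpsi.
have psiE : psi = fun v => \sum_i v ord0 i *: psi (delta_mx ord0 i).
  apply/funext => v; rewrite {1}(row_sum_delta v).
  pose psiL := GRing.isLinear.Build _ _ _ _ psi linpsi.
  pose L : {linear 'rV[R]_n -> X} := HB.pack psi psiL.
  rewrite -[psi]/(L : _ -> _) raddf_sum; apply: eq_bigr => i _.
  exact: linearZ.
rewrite psiE => v; apply: (tvs_cvg_sum (FF := nbhs_filter v)) => i.
apply: (tvs_cvgZ (FF := nbhs_filter v)); last exact: cvg_cst.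
exact: coord_continuous.
Qed.

(** The image of the unit sphere is compact, hence closed, and misses 0; let K be a convex
    neighbourhood of 0 disjoint from it. A point of K with |phi x| >= 1 could be shrunk within K
    onto that image. So |phi| < 1 on K, which gives continuity by scaling. *)
Lemma row_coordinates_continuous (X : tvsType R) (n : nat)
    (phi : X -> 'rV[R]_n) : hausdorff_space X -> linear phi -> bijective phi ->
  continuous phi.
Proof.
move=> hX linphi [psi phiK psiK].
have linpsi : linear psi.
  by move=> a u v; apply: (can_inj phiK); rewrite linphi !psiK.
have cpsi := row_linear_continuous linpsi.
pose S := [set v : 'rV[R]_n | `|v| = 1].
have cS : compact S.
  apply: bounded_closed_compact.
    exists 1; split=> // M M1 v /= ->; exact: ltW.
  have -> : S = (fun v => `|v|) @^-1` [set 1] by [].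
  apply: closed_comp; last exact: closed_eq.
  by move=> v _; exact: norm_continuous.
have clS : closed (psi @` S).
  apply: compact_closed => //; apply: continuous_compact => //.
  exact: continuous_subspaceT.
have phi0 : phi 0 = 0 := linear_map0 linphi.
have psi0 : psi 0 = 0 := linear_map0 linpsi.
have n0 : nbhs (0 : X) (~` (psi @` S)).
  apply: open_nbhs_nbhs; split; first by rewrite openC.
  move=> [v /= v1 v0]; have v00 : v = 0 by rewrite -(psiK v) v0 phi0.
  by have := oner_neq0 R; rewrite -v1 normr_eq0 v00 eqxx.
have [K [oK K0 KS cK]] := nbhs_convex n0.
have phiZ a x : phi (a *: x) = a *: phi x.
  by have := linphi a x 0; rewrite !addr0 phi0 addr0.
have psiZ a x : psi (a *: x) = a *: psi x.
  by have := linpsi a x 0; rewrite !addr0 psi0 addr0.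
have K1 x : K x -> `|phi x| < 1.
  move=> Kx; rewrite ltNge; apply/negP => x1.
  have x0 : 0 < `|phi x| by apply: lt_le_trans x1.
  have := cK x 0 (`|phi x|^-1) _ _ Kx K0; rewrite scaler0 addr0.
  rewrite invr_ge0 normr_ge0 invf_le1 // => /(_ isT x1) /KS; apply.
  exists (`|phi x|^-1 *: phi x); last by rewrite psiZ phiK.
  by rewrite /S /= normrZ normfV normr_id mulVf // gt_eqF.
move=> x0; apply/cvgrPdist_lt => e e0.
have c : (e^-1 *: (x0 - x)) @[x --> x0] --> (0 : X).
  rewrite -[X in _ --> X](scaler0 _ e^-1) -[X in _ --> _ *: X](subrr x0).
  apply: (tvs_cvgZ (FF := nbhs_filter x0)); first exact: cvg_cst.
  by apply: (tvs_cvgB (FF := nbhs_filter x0)); [exact: cvg_cst|exact: cvg_id].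
have Kn : \forall x \near x0, K (e^-1 *: (x0 - x)).
  exact: c K (open_nbhs_nbhs (conj oK K0)).
apply: filterS Kn => x /= /K1.
rewrite phiZ normrZ normfV (ger0_norm (ltW e0)) ltr_pdivrMl // mulr1.
by rewrite (linear_mapB _ _ linphi).
Qed.

(** Joins completeness and norm of row vectors, so that they count as a Banach space. *)
HB.instance Definition _ (n : nat) :=
  Uniform_isComplete.Build 'rV[R]_n (@mx_complete R 1 n).

Lemma finite_dimensional_banachable (X : tvsType R) : hausdorff_space X ->
  finite_dimensional X -> banachable X.
Proof.
move=> hX [n [phi [linphi bphi]]].
have cphi := row_coordinates_continuous hX linphi bphi.
have [psi phiK psiK] := bphi.
exists ('rV[R]_n : completeNormedModType R), phi, psi; split=> //.
apply: row_linear_continuous.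
by move=> a u v; apply: (can_inj phiK); rewrite linphi !psiK.
Qed.

(** X may be infinite-dimensional, so rows in the range are chosen with maximal rank: adding a row G
    x cannot raise it. *)
Lemma row_space_of_linear (X : lmodType R) (n : nat) (G : X -> 'rV[R]_n) :
  linear G -> exists (m : nat) (A : 'M[R]_(m, n)),
    (forall i, range G (row i A)) /\ forall x, (G x <= A)%MS.
Proof.
move=> linG.
pose Q k := `[< exists (m : nat) (A : 'M[R]_(m, n)),
  (forall i, range G (row i A)) /\ \rank A = k >].
have Q0 : exists k, Q k.
  by exists 0%N; apply/asboolP; exists 0%N, 0; split=> [[]|] //; rewrite mxrank0.
have Qn k : Q k -> (k <= n)%N.
  by move=> /asboolP[m [A [_ <-]]]; exact: rank_leq_col.
case: (ex_maxnP Q0 Qn) => k /asboolP[m [A [GA rA]]] maxk.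
exists m, A; split=> // x.
have Qx : Q (\rank (A + G x)%MS).
  apply/asboolP; exists (m + 1)%N, (col_mx A (G x)); split; last first.
    by rewrite addsmxE.
  move=> i; rewrite -[i]fintype.splitK; case: (fintype.split i) => j /=.
    by rewrite rowKu; exact: GA.
  by rewrite rowKd; exists x => //; apply/rowP => l; rewrite mxE ord1.
apply: submx_trans (addsmxSr A (G x)) _.
by rewrite -(geq_leqif (mxrank_leqif_sup (addsmxSl A (G x)))) rA maxk.
Qed.

Lemma regular_into_finite_dimensional (X Y : tvsType R) (T : X -> Y) :
  hausdorff_space Y -> finite_dimensional Y -> linear T -> continuous T ->
  regular_operator T.
Proof.
move=> hY [n [phi [linphi bphi]]] linT cT.
have cphi := row_coordinates_continuous hY linphi bphi.
have linG : linear (phi \o T) by move=> a x y /=; rewrite linT linphi.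
have [m [A [GA GX]]] := row_space_of_linear linG.
have /choice[x_ x_E] : forall i, exists x, phi (T x) = row i A.
  by move=> i; have [x _ xE] := GA i; exists x.
(* For v in the row space, [v *m pinvmx A] gives coefficients of v in the rows of [A], and these
   rows are lifted to the [x_ i]. *)
pose L (v : 'rV[R]_n) : X := \sum_i (v *m pinvmx A) ord0 i *: x_ i.
have linL : linear L.
  move=> a u v; rewrite /L scaler_sumr -big_split; apply: eq_bigr => i _ /=.
  by rewrite mulmxDl -scalemxAl !mxE scalerDl scalerA.
have cL := row_linear_continuous linL.
apply: (@generalized_inverse_regular _ _ _ _ (L \o phi)) => //.
- by move=> a x y /=; rewrite linphi linL.
- by move=> y; apply: continuous_comp; [exact: cphi|exact: cL].
move=> x; apply: (bij_inj bphi) => /=.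
pose GL := GRing.isLinear.Build _ _ _ _ (phi \o T) linG.
pose G : {linear X -> 'rV[R]_n} := HB.pack (phi \o T) GL.
rewrite -[LHS]/(G (L (G x))) -[RHS]/(G x) -[RHS](mulmxKpV (GX x)) /L.
move: (G x *m pinvmx A) => c.
rewrite raddf_sum mulmx_sum_row; apply: eq_bigr => i _.
have := linG (c ord0 i) (x_ i) 0.
by rewrite (linear_map0 linG) !addr0 /= x_E.
Qed.

End finite_dimension.

(** * The local inverse *)

Section smooth_calculus.
Context (R : realType).

Lemma mb_smooth_comp (X Y Z : tvsType R) (U : set X) (V : set Y)
    (f : X -> Y) (g : Y -> Z) : hausdorff_space X -> hausdorff_space Y ->
  hausdorff_space Z -> open U -> open V -> (forall x, U x -> V (f x)) ->
  mb_smooth U f -> mb_smooth V g -> mb_smooth U (g \o f).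
Proof. by move=> ? ? ? ? ? ? fC gC n; exact: mb_C_comp (fC n) (gC n). Qed.

Lemma mb_smooth_linear (X Y : tvsType R) (U : set X) (L : X -> Y) :
  hausdorff_space Y -> linear L -> continuous L -> mb_smooth U L.
Proof. by move=> ? ? ? n; exact: mb_C_linear. Qed.

Lemma mb_smooth_comp_linear (X Y Z : tvsType R) (U : set X)
    (f : X -> Y) (L : Y -> Z) : hausdorff_space X -> hausdorff_space Y ->
  hausdorff_space Z -> open U -> linear L -> continuous L ->
  mb_smooth U f -> mb_smooth U (L \o f).
Proof. by move=> ? ? ? ? ? ? fC n; exact: mb_C_comp_linear (fC n). Qed.

Lemma mb_smooth_add (X Y : tvsType R) (U : set X) (f g : X -> Y) :
  hausdorff_space X -> hausdorff_space Y -> open U ->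
  mb_smooth U f -> mb_smooth U g -> mb_smooth U (fun x => f x + g x).
Proof. by move=> ? ? ? fC gC n; exact: mb_C_add (fC n) (gC n). Qed.

Lemma mb_smooth_sub (X Y : tvsType R) (U : set X) (f g : X -> Y) :
  hausdorff_space X -> hausdorff_space Y -> open U ->
  mb_smooth U f -> mb_smooth U g -> mb_smooth U (fun x => f x - g x).
Proof.
move=> hX hY oU fC gC n; apply: mb_C_add (fC n) _ => //.
exact: mb_C_opp (gC n).
Qed.

Lemma mb_smooth_translation (X : tvsType R) (U : set X) (a : X) :
  hausdorff_space X -> mb_smooth U (fun x => x + a).
Proof.
by move=> hX n; apply: (@mb_C_affine R n X X U idfun a) => // x; exact: cvg_id.
Qed.

Lemma mb_smooth_id (X : tvsType R) (U : set X) :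
  hausdorff_space X -> mb_smooth U (fun x => x).
Proof. by move=> hX n; exact: mb_C_id. Qed.

Lemma is_tvs_derive_linear (X Y : tvsType R) (L : X -> Y) (x v : X) :
  linear L -> is_tvs_derive L x v (L v).
Proof.
move=> linL; have := @is_tvs_derive_affine R X Y L 0 x v linL.
by under eq_fun do rewrite addr0.
Qed.

Lemma is_tvs_deriveD (X Y : tvsType R) (f g : X -> Y) (x v : X) (k l : Y) :
  is_tvs_derive f x v k -> is_tvs_derive g x v l ->
  is_tvs_derive (fun x => f x + g x) x v (k + l).
Proof.
move=> fk gl; apply: (cvg_near_eq (tvs_cvgD fk gl)); apply: nearW => h /=.
by rewrite -scalerDr; congr (_ *: _); rewrite opprD addrACA.
Qed.

Lemma is_tvs_deriveB (X Y : tvsType R) (f g : X -> Y) (x v : X) (k l : Y) :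
  is_tvs_derive f x v k -> is_tvs_derive g x v l ->
  is_tvs_derive (fun x => f x - g x) x v (k - l).
Proof.
move=> fk gl; apply: (cvg_near_eq (tvs_cvgB fk gl)); apply: nearW => h /=.
by rewrite -scalerBr; congr (_ *: _); rewrite !opprD !opprK addrACA.
Qed.

Lemma tvs_derive_linear_comp (X Y Z : tvsType R) (f : X -> Y) (L : Y -> Z)
    (x v : X) (l : Y) : linear L -> continuous L ->
  is_tvs_derive f x v l -> is_tvs_derive (L \o f) x v (L l).
Proof.
move=> linL cL fl.
have H : L (h^-1 *: (f (h *: v + x) - f x)) @[h --> 0^'] --> L l.
  by apply: (cvg_comp _ _ fl); exact: cL.
apply: (cvg_near_eq H); apply: nearW => h /=.
have := linL h^-1 (f (h *: v + x) - f x) 0.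
by rewrite (linear_map0 linL) !addr0 (linear_mapB _ _ linL).
Qed.

End smooth_calculus.

(** * The straightening map and its inverse *)

Section local_normal_form.
Context (R : realType) (X Y : tvsType R) (hX : hausdorff_space X)
  (hY : hausdorff_space Y) (D : set X) (g : X -> Y) (S : Y -> X).
Context (oD : open D) (D0 : D 0) (gC : mb_smooth D g) (g0 : g 0 = 0)
  (linS : linear S) (cS : continuous S).

Let T := tvs_derive g 0.

Let linT : linear T.
Proof. exact: tvs_derive_linear hY oD (gC 1%N) D0. Qed.

Let cT : continuous T.
Proof. exact: tvs_derive_continuous (gC 1%N) D0. Qed.

(** This remainder vanishes at 0 together with its derivative, which makes the fixed point problem
    flat there. *)
Let r x := g x - T x.

Let rC : mb_smooth D r.
Proof. by apply: mb_smooth_sub => //; exact: mb_smooth_linear. Qed.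

(* With z = x + S (r x) and u = - r x, the point x = z + S u is recovered from
   the fixed point equation u = - r (z + S u) in the Banach space Y. *)
Lemma local_inverse : banachable Y ->
  exists (N W : set X) (chi : X -> X),
    [/\ open N, N 0, N `<=` D & open W] /\
    [/\ mb_smooth W chi, forall z, W z -> N (chi z) /\
        chi z + S (r (chi z)) = z &
        forall x, N x -> W (x + S (r x)) -> chi (x + S (r x)) = x] /\ W 0.
Proof.
move=> [B [phi [psi [linphi cphi cpsi phiK psiK]]]].
have hB : hausdorff_space B by exact: norm_hausdorff.
have linpsi : linear psi.
  by move=> a u v; apply: (can_inj phiK); rewrite linphi !psiK.
(* [phi] and [psi] identify Y with the normed space B; in these terms [L] is (z, u) |-> z + S u. *)
pose L (p : X * B) := p.1 + S (psi p.2).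
have linL : linear L.
  by move=> a p q; rewrite /L /= linpsi linS scalerDr addrACA.
have cL : continuous L.
  move=> p; apply: tvs_cvgD; first exact: cvg_fst.
  apply: (@continuous_comp _ _ _ (snd : X * B -> B) (S \o psi)).
    exact: cvg_snd.
  by apply: continuous_comp; [exact: cpsi|exact: cS].
pose O := L @^-1` D.
have oO : open O by move/continuousP : cL; exact.
pose Phi y := - phi y.
have linPhi : linear Phi by move=> a x y; rewrite /Phi linphi opprD scalerN.
have cPhi : continuous Phi by move=> x; apply: tvs_cvgN; exact: cphi.
pose h := Phi \o (r \o L).
have hXB := hausdorff_prod hX hB.
have rLC : mb_smooth O (r \o L).
  by apply: (mb_smooth_comp (V := D)) => //; exact: mb_smooth_linear.
have hC : mb_smooth O h by apply: mb_smooth_comp_linear.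
have T0 : T 0 = 0 := linear_map0 linT.
have r0 : r 0 = 0 by rewrite /r g0 T0 subrr.
have S0 : S 0 = 0 := linear_map0 linS.
have phi0 : phi 0 = 0 := linear_map0 linphi.
have psi0 : psi 0 = 0 := linear_map0 linpsi.
have L0 : L 0 = 0 := linear_map0 linL.
have h0 : h (0, 0) = 0 by rewrite /h /= L0 r0 /Phi phi0 oppr0.
have O0 : O (0, 0) by rewrite /O /= L0.
have dr v : is_tvs_derive r 0 v 0.
  rewrite -(subrr (T v)); apply: is_tvs_deriveB; last exact: is_tvs_derive_linear.
  by apply: tvs_deriveP; have [_ dg _] := gC 1%N; exact: dg.
have rC1 : mb_C 1 D r := rC 1%N.
have dh v : tvs_derive h (0, 0) v = 0.
  apply: is_tvs_derive_unique => //.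
  have Phi0 : Phi 0 = 0 by rewrite /Phi phi0 oppr0.
  rewrite -[X in is_tvs_derive _ _ _ X]Phi0; apply: tvs_derive_linear_comp => //.
  have E : tvs_derive r (L (0, 0)) (L v) = 0.
    by rewrite L0; exact: is_tvs_derive_unique.
  rewrite -[X in is_tvs_derive _ _ _ X]E.
  apply: is_tvs_derive_comp oD rC1 _ _; first by rewrite L0.
  exact: is_tvs_derive_linear.
have [W [rho [u [[oW W0 rho0 uC] [WO uP uU]]]]] :=
  smooth_fixed_point hX oO O0 hC h0 dh.
pose chi z := z + S (psi (u z)).
have psiN y : psi (- y) = - psi y.
  by have := linear_mapB 0 y linpsi; rewrite psi0 !sub0r.
have SN y : S (- y) = - S y.
  by have := linear_mapB 0 y linS; rewrite S0 !sub0r.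
have chiD z : W z -> D (chi z).
  by move=> Wz; have [ur _] := uP z Wz; exact: (WO z (u z) Wz ur).
have ru z : W z -> r (chi z) = - psi (u z).
  by move=> Wz; have [_ ->] := uP z Wz; rewrite /h /Phi /= psiN phiK opprK.
(* The bound by [rho] places - phi (r x) in the ball where fixed points are unique; this makes [chi]
   a left inverse on [N]. *)
pose N := D `&` (phi \o r) @^-1` [set b | `|b| < rho].
exists N, W, chi; split; first split=> //.
- apply: (mb_C_open_preimage (n := 0)) => //; last exact: open_norm_lt.
  exact: (mb_smooth_comp_linear hX hY hB oD linphi cphi rC 0%N).
- by split=> //=; rewrite r0 phi0 normr0.
- by move=> x [].
split=> //; split.
- apply: mb_smooth_add => //; first exact: mb_smooth_id.
  apply: (mb_smooth_comp_linear (f := psi \o u)) => //.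
  exact: mb_smooth_comp_linear.
- move=> z Wz; rewrite ru // SN addrK; split=> //; split; first exact: chiD.
  have [ur _] := uP z Wz.
  have phiN y : phi (- y) = - phi y.
    by have := linear_mapB 0 y linphi; rewrite phi0 !sub0r.
  by rewrite /= ru // phiN psiK normrN.
move=> x [Dx /= rx] Wx; rewrite /chi.
rewrite -(uU (x + S (r x)) (- phi (r x)) Wx).
- by rewrite psiN phiK SN addrK.
- by rewrite normrN.
- by rewrite /h /L /Phi /= psiN phiK SN addrK.
Qed.

End local_normal_form.

(** * The local normal form *)

(** [alpha] and [chi] are mutually inverse coordinate changes of X, [theta] and [theta'] of Y. With
    p = S T, the choice of [chi] gives S g chi = p, so the im component becomes T p. The coker
    component K remains, and the shear [theta] subtracts its value K (p z) on coim. *)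
Lemma local_normal_form (R : realType) (X Y : lcsType R) (D : set X)
    (g : X -> Y) : open D -> D 0 -> mb_smooth D g -> g 0 = 0 ->
  banachable Y -> regular_operator (tvs_derive g 0) ->
  exists (F : normal_form X Y) (A : set X) (E : set Y) (alpha chi : X -> X)
    (theta theta' : Y -> Y),
    [/\ open A, A 0, A `<=` D, alpha 0 = 0 & mb_smooth A alpha] /\
    [/\ mb_smooth (nf_dom F) chi,
        forall x, A x -> nf_dom F (alpha x) /\ chi (alpha x) = x &
        forall z, nf_dom F z -> A (chi z) /\ alpha (chi z) = z] /\
    [/\ open E, theta 0 = 0, mb_smooth E theta & mb_smooth E theta'] /\
    [/\ E 0, forall y, E y -> E (theta y) /\ theta' (theta y) = y &
        forall y, E y -> E (theta' y) /\ theta (theta' y) = y] /\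
    forall z, nf_dom F z -> E (g (chi z)) /\ theta (g (chi z)) = nf_map F z.
Proof.
move=> oD D0 gC g0 bY regT; set T := tvs_derive g 0 in regT.
have hX := @lcs_hausdorff _ X; have hY := @lcs_hausdorff _ Y.
have [linT cT _ _ _ _ _] := regT.
have [S [linS cS TST STS]] := regular_generalized_inverse regT.
have [N [W [chi [[oN N0 ND oW] [[chiC chiP chiK] W0]]]]] :=
  local_inverse hX hY oD D0 gC g0 linS cS bY.
have T0 := linear_map0 linT; have S0 := linear_map0 linS.
pose psi x := x + S (g x - T x).
have psi0 : psi 0 = 0 by rewrite /psi g0 T0 subrr S0 addr0.
have psiC : mb_smooth N psi.
  apply: mb_smooth_add => //; first exact: mb_smooth_id.
  apply: (mb_smooth_comp_linear (f := fun x => g x - T x)) => //.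
  apply: mb_smooth_sub => //; last exact: mb_smooth_linear.
  by move=> n; apply: mb_C_sub (gC n).
(* [p], [Q] and [q] project onto coim, im and coker. *)
pose p x := S (T x); pose Q y := T (S y); pose q y := y - Q y.
have linp : linear p by move=> a x y; rewrite /p linT linS.
have linQ : linear Q by move=> a x y; rewrite /Q linS linT.
have linq : linear q by move=> a x y; rewrite /q linQ scalerBr opprD addrACA.
have cp : continuous p.
  by move=> x; apply: (@continuous_comp _ _ _ T S); [exact: cT|exact: cS].
have cQ : continuous Q.
  by move=> x; apply: (@continuous_comp _ _ _ S T); [exact: cS|exact: cT].
have cq : continuous q.
  by move=> x; apply: tvs_cvgB; [exact: cvg_id|exact: cQ].
have idp x : p (p x) = p x by rewrite /p TST.
have idQ y : Q (Q y) = Q y by rewrite /Q STS.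
have Sq y : S (q y) = 0 by rewrite /q (linear_mapB _ _ linS) /Q STS subrr.
have qT x : q (T x) = 0 by rewrite /q /Q TST subrr.
have Qq y : Q (q y) = 0 by rewrite /Q Sq T0.
have p0 : p 0 = 0 := linear_map0 linp.
have q0 : q 0 = 0 := linear_map0 linq.
have chi0 : chi 0 = 0.
  by have := chiK 0 N0; rewrite -[0 + _]/(psi 0) psi0; exact.
(* The term K (p z) in [sing] requires p z in [W] as well. *)
pose W2 := W `&` p @^-1` W.
have oW2 : open W2.
  by apply: openI => //; have /continuousP := cp; exact.
have W20 : W2 0 by split=> //=; rewrite p0.
pose K := q \o (g \o chi).
have gchiC : mb_smooth W (g \o chi).
  apply: (mb_smooth_comp (V := D)) => // z Wz.
  by apply: ND; have [] := chiP z Wz.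
have KC : mb_smooth W K by apply: mb_smooth_comp_linear.
have KpC : mb_smooth W2 (K \o p).
  apply: (mb_smooth_comp (V := W)) => //; first by move=> z [].
  exact: mb_smooth_linear.
pose sing z := K z - K (p z).
have singC : mb_smooth W2 sing.
  by apply: mb_smooth_sub => // n; apply: mb_C_sub (KC n) => z [].
(* The derivative of [K] at 0 is that of [chi] followed by q T, and q T = 0. *)
have dK v : is_tvs_derive K 0 v 0.
  have [_ dchi _] := chiC 1%N; have [l dl] := dchi 0 v W0.
  have -> : 0 = q (T l) :> Y by rewrite qT.
  apply: tvs_derive_linear_comp => //.
  have -> : T l = tvs_derive g (chi 0) l by rewrite chi0.
  by apply: is_tvs_derive_comp oD (gC 1%N) _ dl; rewrite chi0.
have dsing v : tvs_derive sing 0 v = 0.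
  apply: is_tvs_derive_unique => //.
  have dKp : is_tvs_derive (K \o p) 0 v 0.
    have := dK (p v); rewrite /is_tvs_derive.
    have -> // : (fun h : R => h^-1 *: (K (h *: p v + 0) - K 0)) =
      (fun h => h^-1 *: ((K \o p) (h *: v + 0) - (K \o p) 0)).
    by apply/funext => h /=; rewrite linp p0.
  by have := is_tvs_deriveB (dK v) dKp; rewrite subrr.
have singcoker z : W2 z -> Q (sing z) = 0.
  by move=> _; rewrite /sing (linear_mapB _ _ linQ) /K /= !Qq subrr.
have singcoim z : W2 z -> p z = z -> sing z = 0.
  by move=> _ pz; rewrite /sing pz subrr.
pose DX := projection_decomposition linp cp idp.
pose DY := projection_decomposition linQ cQ idQ.
(* [T] and [S] are total maps that restrict to mutually inverse isomorphisms between coim and im. *)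
pose F : normal_form X Y := @NormalForm R X Y DX DY T S
  (fun a x y _ _ => linT a x y) (fun x _ => TST x) (fun y _ => STS y)
  (fun x (px : p x = x) => px) (fun y (Qy : Q y = y) => Qy)
  (continuous_subspaceT cT) (continuous_subspaceT cS) W2 oW2 W20 sing
  singcoker singC singcoim dsing.
pose E := S @^-1` W.
have oE : open E by have /continuousP := cS; exact.
(* [k] takes values in coker, where [S] vanishes, so y - k y and y have the same image under [S]. As
   k y depends only on S y, the map y + k y inverts the shear. *)
pose k y := q (g (chi (S y))).
have kC : mb_smooth E k.
  apply: (mb_smooth_comp (V := W) (f := S) (g := K)) => //.
  exact: mb_smooth_linear.
have k0 : k 0 = 0 by rewrite /k S0 chi0 g0 q0.
pose theta y := y - k y; pose theta' y := y + k y.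
have Stheta y : S (theta y) = S y.
  by rewrite /theta (linear_mapB _ _ linS) /k Sq subr0.
have Stheta' y : S (theta' y) = S y.
  by rewrite /theta' (linear_mapD _ _ linS) /k Sq addr0.
exists F, (N `&` psi @^-1` W2), E, psi, chi, theta, theta'.
(* Apply [p] to chi z + S (g (chi z) - T (chi z)) = z: since p S = S, the terms in [T] cancel. *)
have gchi z : W z -> S (g (chi z)) = p z.
  move=> Wz; have [_ e] := chiP z Wz.
  have : p (chi z + S (g (chi z) - T (chi z))) = p z.
    by congr p; exact: e.
  by rewrite (linear_mapD _ _ linp) /p STS (linear_mapB _ _ linS) addrC subrK.
split; [|split; [|split; [|split]]].
- split=> //.
  + by apply: (mb_C_open_preimage oN (psiC 0%N)).
  + by split=> //=; rewrite psi0.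
  + by move=> x [/ND].
  + by move=> n; apply: mb_C_sub (psiC n) => x [].
- split=> //=.
  + by move=> n; apply: mb_C_sub (chiC n) => x [].
  + by move=> x [Nx /= W2x]; split=> //; apply: chiK => //; case: W2x.
  + move=> z [Wz pz]; have [Nz e] := chiP z Wz.
    have {}e : psi (chi z) = z by exact: e.
    by split=> //; split=> //=; rewrite e.
- split=> //; first by rewrite /theta k0 subr0.
  + by apply: mb_smooth_sub => //; exact: mb_smooth_id.
  + by apply: mb_smooth_add => //; exact: mb_smooth_id.
- split; first by rewrite /E /= S0.
  + move=> y Ey; split; first by rewrite /E /= Stheta.
    by rewrite /theta' /k Stheta subrK.
  + move=> y Ey; split; first by rewrite /E /= Stheta'.
    by rewrite /theta /k Stheta' addrK.
- move=> z [Wz pz]; split; first by rewrite /E /= gchi.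
  (* Here g (chi z) = T (p z) + K z, while k (g (chi z)) = K (p z). *)
  rewrite /theta /k gchi // /nf_map /= /sing /K /=.
  by rewrite addrA; congr (_ - _); rewrite /q /Q gchi // addrC subrK.
Qed.

(** * Charts *)

Section charts.
Context (R : realType).

Lemma mb_smooth_sub_set (X Y : tvsType R) (U V : set X) (f : X -> Y) :
  V `<=` U -> mb_smooth U f -> mb_smooth V f.
Proof. by move=> VU fC n; exact: mb_C_sub (fC n). Qed.

Lemma open_transition (M : topologicalType) (X Y : tvsType R) (c : chart M X)
    (d : chart M Y) : open (cimg c `&` cinv c @^-1` cdom d).
Proof.
apply: open_preimage_in; [exact: cimg_open| |exact: cdom_open].
exact: cinv_continuous.
Qed.

(** Transition maps between the new chart and an atlas chart e factor as [(e \o cinv c) \o beta] and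
    [alpha \o (c \o cinv e)], so the new chart belongs to the maximal atlas. *)
Lemma chart_change (M : lcManifold R) (X Z : lcsType R) (c : chart M X)
    (A : set X) (A' : set Z) (alpha : X -> Z) (beta : Z -> X) :
  atlas c -> open A -> A `<=` cimg c -> open A' ->
  mb_smooth A alpha -> mb_smooth A' beta ->
  (forall x, A x -> A' (alpha x) /\ beta (alpha x) = x) ->
  (forall z, A' z -> A (beta z) /\ alpha (beta z) = z) ->
  exists c' : chart M Z,
    [/\ smooth_chart c', cdom c' = cdom c `&` c @^-1` A, cimg c' = A',
        c' = alpha \o c :> (M -> Z) & cinv c' = cinv c \o beta].
Proof.
move=> ac oA Ac oA' aC bC ab ba.
have hX := @lcs_hausdorff _ X; have hZ := @lcs_hausdorff _ Z.
have odom : open (cdom c `&` c @^-1` A).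
  by apply: open_preimage_in => //; [exact: cdom_open|exact: cfun_continuous].
have img t : (cdom c `&` c @^-1` A) t -> A' ((alpha \o c) t).
  by move=> [_ /= At]; have [] := ab _ At.
have dom z : A' z -> (cdom c `&` c @^-1` A) ((cinv c \o beta) z).
  move=> /ba[Az _]; split; first by apply: cinv_dom; exact: Ac.
  by rewrite /= cinvK //; exact: Ac.
have funK t : (cdom c `&` c @^-1` A) t -> (cinv c \o beta) ((alpha \o c) t) = t.
  by move=> [ct /= /ab[_ ->]]; rewrite cfunK.
have invK z : A' z -> (alpha \o c) ((cinv c \o beta) z) = z.
  by move=> /ba[Az bz] /=; rewrite cinvK //; exact: Ac.
have cfun : {in cdom c `&` c @^-1` A, continuous (alpha \o c)}.
  move=> t; rewrite inE => -[ct At]; apply: continuous_comp.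
    by apply: cfun_continuous; rewrite inE.
  exact: mb_C_continuous (aC 0%N) _ At.
have cinv' : {in A', continuous (cinv c \o beta)}.
  move=> z; rewrite inE => Az; apply: continuous_comp.
    exact: mb_C_continuous (bC 0%N) _ Az.
  by apply: cinv_continuous; rewrite inE; apply: Ac; have [] := ba z Az.
exists (@Chart R M Z _ A' (alpha \o c) (cinv c \o beta) odom oA' img dom funK
  invK cfun cinv'); split=> // Y e ae.
have hY := @lcs_hausdorff _ Y.
have [ce ec] := atlas_compatible ac ae.
have oce := open_transition c e; have oec := open_transition e c.
split; rewrite /smooth_transition /=.
- have oU : open (A' `&` beta @^-1` (cimg c `&` cinv c @^-1` cdom e)).
    exact: mb_C_open_preimage oA' (bC 0%N) oce.
  have -> : A' `&` (cinv c \o beta) @^-1` cdom e =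
      A' `&` beta @^-1` (cimg c `&` cinv c @^-1` cdom e).
    apply/seteqP; split=> z [Az] /= => [ez|[_ ez]] //; split=> //; split=> //.
    by apply: Ac; have [] := ba z Az.
  apply: (mb_smooth_comp (V := cimg c `&` cinv c @^-1` cdom e) (f := beta)
    (g := e \o cinv c)) => //; first by move=> z [].
  by apply: mb_smooth_sub_set bC => z [].
- have oU : open ((cimg e `&` cinv e @^-1` cdom c) `&` (c \o cinv e) @^-1` A).
    exact: mb_C_open_preimage oec (ec 0%N) oA.
  have -> : cimg e `&` cinv e @^-1` (cdom c `&` c @^-1` A) =
      (cimg e `&` cinv e @^-1` cdom c) `&` (c \o cinv e) @^-1` A.
    by rewrite preimage_setI setIA.
  apply: (mb_smooth_comp (V := A) (f := c \o cinv e) (g := alpha)) => //.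
    by move=> z [].
  by apply: mb_smooth_sub_set ec => z [].
Qed.

Lemma chart_atP (M : lcManifold R) (m : M) :
  atlas (chart_at m) /\ cdom (chart_at m) m.
Proof. exact: (svalP (cid (svalP (cid (atlas_cover m))))). Qed.

Lemma open_chart_rep (M N : lcManifold R) (f : M -> N) (X Y : lcsType R)
    (c : chart M X) (d : chart N Y) : continuous f ->
  open (cimg c `&` (f \o cinv c) @^-1` cdom d).
Proof.
move=> cf; apply: open_preimage_in; [exact: cimg_open| |exact: cdom_open].
move=> x cx; apply: continuous_comp; last exact: cf.
exact: cinv_continuous.
Qed.

(** The chosen charts are centred by translations, the local normal form is applied to the centred
    representative, and its coordinate changes are absorbed into the charts. *)
Lemma regular_has_normal_form (M N : lcManifold R) (f : M -> N) (m : M) :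
  banachable (model_at (f m)) -> smooth_map f ->
  regular_operator (tangent_map f m) -> has_normal_form f m.
Proof.
move=> bY [cf fC] regT.
set X := model_at m; set Y := model_at (f m) in bY.
have hX := @lcs_hausdorff _ X; have hY := @lcs_hausdorff _ Y.
set c := chart_at m; set d := chart_at (f m).
have [ac cm] : atlas c /\ cdom c m := chart_atP m.
have [ad dfm] : atlas d /\ cdom d (f m) := chart_atP (f m).
set x0 := c m; set y0 := d (f m).
pose F0 := d \o f \o cinv c.
pose D0 := cimg c `&` (f \o cinv c) @^-1` cdom d.
have oD0 : open D0 by exact: open_chart_rep.
have F0C : mb_smooth D0 F0 by exact: fC.
have D0x0 : D0 x0 by split; [exact: cfun_img|rewrite /= cfunK].
have F0x0 : F0 x0 = y0 by rewrite /F0 /= cfunK.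
pose D := [set x | D0 (x + x0)].
have oD : open D by exact: open_addr.
pose g x := F0 (x + x0) - y0.
have gC : mb_smooth D g.
  apply: (mb_smooth_comp (V := setT) (f := fun x => F0 (x + x0))
    (g := fun y => y - y0)) => //.
  - exact: openT.
  - apply: (mb_smooth_comp (V := D0) (f := fun x => x + x0) (g := F0)) => //.
    exact: mb_smooth_translation.
  - exact: mb_smooth_translation.
(* Translations in source and target leave the difference quotients unchanged. *)
have dg : tvs_derive g 0 = tangent_map f m.
  apply/funext => v; rewrite /tangent_map /tvs_derive; congr xget.
  apply/funext => l; rewrite /= /is_tvs_derive.
  suff -> : (fun h : R => h^-1 *: (g (h *: v + 0) - g 0)) =
    (fun h => h^-1 *: (F0 (h *: v + x0) - F0 x0)) by [].
  by apply/funext => h; rewrite /g addr0 add0r opprB addrA subrK.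
have D00 : D 0 by rewrite /D /= add0r.
have g0 : g 0 = 0 by rewrite /g add0r F0x0 subrr.
have regg : regular_operator (tvs_derive g 0) by rewrite dg.
have [F [A [E [alpha [chi [theta [theta' [HA [HF [HE [HE' Hnf]]]]]]]]]]] :=
  local_normal_form oD D00 gC g0 bY regg.
have {HA}[oA A0 AD alpha0 alphaC] := HA.
have {HF}[chiC alphaK chiK] := HF.
have {HE}[oE theta0 thetaC theta'C] := HE.
have {HE'}[E0 thetaK theta'K] := HE'.
have := @chart_change M X X c [set x | A (x - x0)] (nf_dom F)
  (fun x => alpha (x - x0)) (fun z => chi z + x0) ac.
case.
- exact: open_addr.
- by move=> x /= /AD; rewrite /D /= subrK => -[].
- exact: nf_dom_open.
- apply: (mb_smooth_comp (V := A) (f := fun x => x - x0) (g := alpha)) => //.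
    exact: open_addr.
  exact: mb_smooth_translation.
- apply: (mb_smooth_comp (V := setT) (f := chi) (g := fun x => x + x0)) => //.
  + exact: nf_dom_open.
  + exact: openT.
  + exact: mb_smooth_translation.
- by move=> x /= Ax; have [Fx e] := alphaK _ Ax; rewrite e subrK.
- by move=> z /= Fz; rewrite addrK; exact: chiK.
move=> kappa [skappa kdom kimg kfun kinv].
(* [theta'] preserves [E], but after translation by [y0] its values must also lie in the image of
   [d]. *)
pose E' := E `&` [set y | cimg d (theta' y + y0)].
have oE' : open E'.
  exact: (mb_C_open_preimage oE (theta'C 0%N) (open_addr y0 (cimg_open d))).
have := @chart_change N Y Y d (cimg d `&` [set y | E (y - y0)]) E'
  (fun y => theta (y - y0)) (fun y => theta' y + y0) ad.
case.
- by apply: openI; [exact: cimg_open|exact: open_addr].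
- by move=> y [].
- exact: oE'.
- apply: (mb_smooth_comp (V := E) (f := fun y => y - y0) (g := theta)) => //.
  + by apply: openI; [exact: cimg_open|exact: open_addr].
  + by move=> y [].
  + exact: mb_smooth_translation.
- apply: (mb_smooth_comp (V := setT) (f := theta') (g := fun y => y + y0)) => //.
  + exact: openT.
  + by apply: mb_smooth_sub_set theta'C => y [].
  + exact: mb_smooth_translation.
- move=> y /= [dy Ey]; have [Ey' e] := thetaK _ Ey.
  by split; [split=> //=; rewrite e subrK|rewrite e subrK].
- move=> y /= [Ey dy]; have [Ey' e] := theta'K _ Ey.
  by rewrite addrK; split=> //; split=> //=; rewrite addrK.
move=> rho [srho rdom rimg rfun rinv].
have gE t : cdom c t -> A (c t - x0) ->
    cdom d (f t) /\ g (c t - x0) = d (f t) - y0.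
  move=> ct /AD; rewrite /D /D0 /= subrK /g /F0 subrK /= cfunK //.
  by move=> [_ ?].
exists X, Y, F, kappa, rho; split; [|split]; split.
- exact: skappa.
- by rewrite kdom; split=> //=; rewrite subrr.
- by rewrite kfun /= subrr.
- exact: srho.
- rewrite rdom; split=> //; split; first exact: cfun_img.
  by rewrite /= subrr.
- by rewrite rfun /= subrr.
- move=> _ [t + <-]; rewrite kdom => -[ct /= At].
  have [dft gt] := gE t ct At; rewrite rdom; split=> //; split.
    exact: cfun_img.
  have [Fa e] := alphaK _ At.
  by rewrite /= -gt -e; have [] := Hnf _ Fa.
- by rewrite kimg.
- rewrite kimg => z Fz; rewrite kinv rfun /=.
  have [_ <-] := Hnf z Fz; congr theta.
Qed.

(** The composite of the two transition maps is the identity near k t, and the chain rule computes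
    its derivative. *)
Lemma transition_derive_inverse (M : topologicalType) (X Z : lcsType R)
    (c : chart M X) (k : chart M Z) (t : M) (v : Z) :
  compatible c k -> cdom c t -> cdom k t ->
  tvs_derive (k \o cinv c) (c t) (tvs_derive (c \o cinv k) (k t) v) = v.
Proof.
move=> [ck kc] ct kt; have hZ := @lcs_hausdorff _ Z.
have Uc : (cimg c `&` cinv c @^-1` cdom k) (c t).
  by split; [exact: cfun_img|rewrite /= cfunK].
have Uk : (cimg k `&` cinv k @^-1` cdom c) (k t).
  by split; [exact: cfun_img|rewrite /= cfunK].
have cktE : (c \o cinv k) (k t) = c t by rewrite /= cfunK.
have [_ dk _] := kc 1%N.
have H : is_tvs_derive ((k \o cinv c) \o (c \o cinv k)) (k t) v
    (tvs_derive (k \o cinv c) ((c \o cinv k) (k t))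
       (tvs_derive (c \o cinv k) (k t) v)).
  apply: is_tvs_derive_comp (open_transition c k) (ck 1%N) _ _.
    by rewrite cktE.
  by apply: tvs_deriveP; exact: dk.
rewrite cktE in H; apply: (cvg_unique hZ H).
apply: (@is_tvs_derive_near R Z Z idfun); last exact: is_tvs_derive_linear.
apply: filterS (open_nbhs_nbhs (conj (open_transition k c) Uk)).
by move=> z [kz cz] /=; rewrite cfunK // cinvK.
Qed.

(** With [p] the projection onto coim or im, this turns continuity of [nf_hat] or its inverse on a
    subspace into continuity on the whole space. *)
Lemma within_continuous_comp (X Y Z : topologicalType) (A : set Y) (p : X -> Y)
    (h : Y -> Z) : {within A, continuous h} -> continuous p ->
  (forall x, A (p x)) -> continuous (h \o p).
Proof.
move=> /subspace_continuousP hA cp Ap x U nU.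
have H : \forall y \near x, A (p y) -> U (h (p y)).
  exact: cp x _ (hA _ (Ap x) U nU).
by apply: (filterS _ H) => y; apply.
Qed.

(** * The derivative of a normal form at the origin *)

Section normal_form_derivative.
Context (X Y : lcsType R) (F : normal_form X Y).

Definition nf_linear_part (x : X) : Y := nf_hat F (pr2 (nf_source F) x).

Definition nf_linear_inverse (y : Y) : X :=
  nf_hat_inv F (pr2 (nf_target F) y).

Lemma nf_linear_part_linear : linear nf_linear_part.
Proof.
move=> a x y; rewrite /nf_linear_part (pr_linear _).2 nf_hat_linear //;
  exact: pr2_in.
Qed.

Lemma nf_linear_part_continuous : continuous nf_linear_part.
Proof.
apply: within_continuous_comp; [exact: nf_hat_continuous| |exact: pr2_in].
exact: pr2_continuous.
Qed.

(** Only [nf_hat] is given as linear; its inverse inherits linearity once u and w are written as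
    images under [nf_hat]. *)
Lemma nf_linear_inverse_linear : linear nf_linear_inverse.
Proof.
move=> a y z; rewrite /nf_linear_inverse (pr_linear _).2.
set u := pr2 _ y; set w := pr2 _ z.
have iu : nf_im F u by exact: pr2_in.
have iw : nf_im F w by exact: pr2_in.
have cu := nf_hat_inv_coim iu; have cw := nf_hat_inv_coim iw.
rewrite -{1}(nf_hat_invK iu) -{1}(nf_hat_invK iw) -nf_hat_linear //.
by apply: nf_hatK; have [_] := summand2_subspace (nf_source F); exact.
Qed.

Lemma nf_linear_inverse_continuous : continuous nf_linear_inverse.
Proof.
apply: within_continuous_comp; [exact: nf_hat_inv_continuous| |exact: pr2_in].
exact: pr2_continuous.
Qed.

Lemma nf_linear_partK x :
  nf_linear_part (nf_linear_inverse (nf_linear_part x)) = nf_linear_part x.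
Proof.
have cx : nf_coim F (pr2 (nf_source F) x) by exact: pr2_in.
have ix := nf_hat_im cx.
rewrite /nf_linear_inverse {2}/nf_linear_part (pr2_id ix) nf_hatK //.
by rewrite /nf_linear_part (pr2_id cx).
Qed.

Lemma nf_map_smooth : mb_smooth (nf_dom F) (nf_map F).
Proof.
have hX := @lcs_hausdorff _ X; have hY := @lcs_hausdorff _ Y.
apply: mb_smooth_add => //; [exact: nf_dom_open| |exact: nf_sing_smooth].
apply: mb_smooth_linear => //; first exact: nf_linear_part_linear.
exact: nf_linear_part_continuous.
Qed.

Lemma nf_map_derive v : is_tvs_derive (nf_map F) 0 v (nf_linear_part v).
Proof.
(* [nf_sing_derive0] alone could hold through the default value 0 of [tvs_derive]; smoothness
   supplies the existence of the limit. *)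
have [_ ds _] := @nf_sing_smooth _ _ _ F 1%N.
have H := tvs_deriveP (ds 0 v (nf_dom0 F)); rewrite nf_sing_derive0 in H.
have := is_tvs_deriveD (@is_tvs_derive_linear R X Y _ 0 v nf_linear_part_linear) H.
by rewrite addr0.
Qed.

End normal_form_derivative.

(** By the chain rule T = P L B, with L the linear part of the normal form and P, B derivatives of
    transition maps. If L I L = L, then S = B' I P' satisfies T S T = T, because B B' = 1 and P' P =
    1. *)
Lemma normal_form_regular (M N : lcManifold R) (f : M -> N) (m : M) :
  continuous f -> has_normal_form f m -> regular_operator (tangent_map f m).
Proof.
move=> cf [X' [Y' [F [kappa [rho [[sk km k0] [[sr rm r0] [fkr kF fE]]]]]]]].
rewrite /tangent_map /tangent_space.
set X := model_at m; set Y := model_at (f m).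
have hX := @lcs_hausdorff _ X; have hY := @lcs_hausdorff _ Y.
have hX' := @lcs_hausdorff _ X'; have hY' := @lcs_hausdorff _ Y'.
set c := chart_at m; set d := chart_at (f m).
have [ac cm] : atlas c /\ cdom c m := chart_atP m.
have [ad dfm] : atlas d /\ cdom d (f m) := chart_atP (f m).
have [kc ck] := sk _ _ ac; have [rd dr] := sr _ _ ad.
pose P := tvs_derive (d \o cinv rho) (rho (f m)).
pose P' := tvs_derive (rho \o cinv d) (d (f m)).
pose B := tvs_derive (kappa \o cinv c) (c m).
pose B' := tvs_derive (c \o cinv kappa) (kappa m).
have BB' x : B (B' x) = x by apply: transition_derive_inverse.
have P'P y : P' (P y) = y by apply: transition_derive_inverse.
have Uc : (cimg c `&` cinv c @^-1` cdom kappa) (c m).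
  by split; [exact: cfun_img|rewrite /= cfunK].
have Uk : (cimg kappa `&` cinv kappa @^-1` cdom c) (kappa m).
  by split; [exact: cfun_img|rewrite /= cfunK].
have Ur : (cimg rho `&` cinv rho @^-1` cdom d) (rho (f m)).
  by split; [exact: cfun_img|rewrite /= cfunK].
have Ud : (cimg d `&` cinv d @^-1` cdom rho) (d (f m)).
  by split; [exact: cfun_img|rewrite /= cfunK].
have oc := open_transition c kappa; have ok := open_transition kappa c.
have or := open_transition rho d; have od := open_transition d rho.
have linP : linear P := tvs_derive_linear hY or (rd 1%N) Ur.
have cP : continuous P := tvs_derive_continuous (rd 1%N) Ur.
have linP' : linear P' := tvs_derive_linear hY' od (dr 1%N) Ud.
have cP' : continuous P' := tvs_derive_continuous (dr 1%N) Ud.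
have linB : linear B := tvs_derive_linear hX' oc (ck 1%N) Uc.
have cB : continuous B := tvs_derive_continuous (ck 1%N) Uc.
have linB' : linear B' := tvs_derive_linear hX ok (kc 1%N) Uk.
have cB' : continuous B' := tvs_derive_continuous (kc 1%N) Uk.
have linL := nf_linear_part_linear F; have cL := @nf_linear_part_continuous _ _ F.
have linI := nf_linear_inverse_linear F.
have cI := @nf_linear_inverse_continuous _ _ F.
have nf0 : nf_map F 0 = 0.
  by rewrite -k0 -fE ?cfunK //; exact: cfun_img.
have TE : tvs_derive (d \o f \o cinv c) (c m) = P \o (nf_linear_part F \o B).
  apply/funext => v; apply: is_tvs_derive_unique => //.
  (* Near c m the local representative factors through the charts [kappa] and [rho], between which f
     is [nf_map]. *)
  apply: (@is_tvs_derive_near _ _ _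
    ((d \o cinv rho) \o (nf_map F \o (kappa \o cinv c)))).
    apply: filterS (open_nbhs_nbhs (conj oc Uc)) => x [cx kx] /=.
    rewrite -fE; last exact: cfun_img.
    by rewrite (cfunK kx) cfunK //; apply: fkr; exists (cinv c x).
  have kc0 : (kappa \o cinv c) (c m) = 0 by rewrite /= cfunK.
  have [_ dck _] := ck 1%N.
  have H1 := tvs_deriveP (dck _ v Uc).
  have H2 : is_tvs_derive (nf_map F \o (kappa \o cinv c)) (c m) v
      (nf_linear_part F (B v)).
    have <- : tvs_derive (nf_map F) ((kappa \o cinv c) (c m)) (B v) =
        nf_linear_part F (B v).
      by rewrite kc0; apply: is_tvs_derive_unique => //; exact: nf_map_derive.
    apply: is_tvs_derive_comp (@nf_dom_open _ _ _ F) (@nf_map_smooth _ _ F 1%N) _ H1.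
    by rewrite kc0; exact: nf_dom0.
  have e : (nf_map F \o (kappa \o cinv c)) (c m) = rho (f m).
    by rewrite /= cfunK // k0 nf0 r0.
  rewrite /= /P -e; apply: is_tvs_derive_comp or (rd 1%N) _ H2.
  by rewrite e.
apply: (@generalized_inverse_regular _ _ _ _
  (B' \o (nf_linear_inverse F \o P'))) => //; rewrite ?TE.
- by move=> a x y /=; rewrite linB linL linP.
- move=> x; apply: continuous_comp; last exact: cP.
  by apply: continuous_comp; [exact: cB|exact: cL].
- by move=> a x y /=; rewrite linP' linI linB'.
- move=> x; apply: continuous_comp; last exact: cB'.
  by apply: continuous_comp; [exact: cP'|exact: cI].
- by move=> x /=; rewrite BB' P'P nf_linear_partK.
Qed.

End charts.

Theorem theorem3p7 (R : realType) :
  (forall (M N : lcManifold R) (f : M -> N) (m : M),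
     banach_manifold N -> smooth_map f ->
     has_normal_form f m <-> regular_operator (tangent_map f m)) /\
  (forall (M N : lcManifold R) (f : M -> N),
     finite_dim_manifold N -> smooth_map f ->
     forall m : M, has_normal_form f m).
Proof.
split=> M N f => [m bN fC|fdN fC m].
  split; first exact: normal_form_regular (proj1 fC).
  apply: regular_has_normal_form => //.
  by apply: bN; exact: (chart_atP (f m)).1.
have [ac cm] := chart_atP m; have [ad dfm] := chart_atP (f m).
have hY := @lcs_hausdorff _ (model_at (f m)).
have fdY := fdN _ _ ad.
(* A finite-dimensional Hausdorff space is a Banach space, and every continuous linear map into it
   is regular. *)
apply: regular_has_normal_form => //.
  exact: finite_dimensional_banachable.
have fmC := proj2 fC _ _ _ _ ac ad 1%N.
have oD := open_chart_rep (chart_at m) (chart_at (f m)) (proj1 fC).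
have Dm : (cimg (chart_at m) `&`
    (f \o cinv (chart_at m)) @^-1` cdom (chart_at (f m))) (chart_at m m).
  by split; [exact: cfun_img|rewrite /= cfunK].
apply: regular_into_finite_dimensional => //.
  exact: tvs_derive_linear hY oD fmC Dm.
exact: tvs_derive_continuous fmC Dm.
Qed.
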